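(* Let $(\Omega,\mathcal F,\mathbb P)$ be an atomless probability space. A set $\mathcal D\subseteq\mathcal C_2$ is a maximal bivariate concentration class if and only if $\mathcal D=\mathcal D_p$ for some $p\in(0,1)$, where $\mathcal D_p=\{C\in\mathcal C_2:C(p,p)=p\}$.
   Context: $(\Omega,\mathcal F,\mathbb P)$ is an atomless probability space; $L^\infty_c$ is the set of essentially bounded random variables on it with continuous distribution. $\mathcal C_2$ is the set of bivariate copulas (joint distribution functions with standard uniform marginals). For random variables with continuous distributions the copula of a pair is unique. For copulas, $C\le C'$ means pointwise inequality of functions. For $C\in\mathcal C_2$, a sequence $(X_n)_{n\in\mathbb N}$ of random variables in $L^\infty_c$ is sequentially $C$-coupled if $X_n\overset{d}{=}X_{n+1}$ (equality in law) and $C$ is the copula of $(X_n,X_{n+1})$ for each $n\in\mathbb N$. $C$ is non-diversifiable if for every sequentially $C$-coupled sequence $(X_n)_{n\in\mathbb N}$ in $L^\infty_c$, the averages $\frac1n\sum_{i=1}^nX_i-\mathbb E[X_1]$ do not converge to $0$ in probability as $n\to\infty$. A bivariate concentration class is a subset $\mathcal D\subseteq\mathcal C_2$ satisfying: [ND] each $C\in\mathcal D$ is non-diversifiable; [DM] if $C\in\mathcal D$, $C'\in\mathcal C_2$ and $C\le C'$, then $C'\in\mathcal D$; [Cx] if $C_n\in\mathcal D$ for all $n\in\mathbb N$, then $\sum_{n\in\mathbb N}\lambda_nC_n\in\mathcal D$ for all $\lambda_n\ge0$ with $\sum_{n\in\mathbb N}\lambda_n=1$. A bivariate concentration class $\mathcal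 D$ is maximal if there is no bivariate concentration class $\mathcal D'\ne\mathcal D$ with $\mathcal D\subseteq\mathcal D'$. *)

(* Defs.v *)
(* MathComp-Analysis *)
From HB Require Import structures.
From mathcomp Require Import all_boot all_order all_algebra.
From mathcomp Require Import all_classical all_reals all_analysis.

Set Implicit Arguments.
Unset Strict Implicit.
Unset Printing Implicit Defensive.

Import Order.TTheory GRing.Theory Num.Theory.
Import numFieldNormedType.Exports.

Local Open Scope classical_set_scope.
Local Open Scope ring_scope.

Definition atomless d (T : measurableType d) (R : realType)
    (P : probability T R) : Prop :=
  forall A : set T, measurable A -> (0 < P A)%E ->
    exists B : set T,
      [/\ measurable B, B `<=` A, (0 < P B)%E & (P B < P A)%E].

(* A bivariate copula is kept as a joint distribution function on the whole
   plane. It is determined by its restriction to the unit square, since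
   C u v = C (clamp u) (clamp v) with clamp the projection of R onto [0, 1];
   so equality and pointwise order of copulas on the plane and on the unit
   square agree. *)
Definition copula2 (R : realType) : set (R -> R -> R) :=
  [set C | exists mu : probability (R * R)%type R,
    [/\ forall A : set R, measurable A ->
          mu (fst @^-1` A) = uniform_prob (@ltr01 R) A,
        forall A : set R, measurable A ->
          mu (snd @^-1` A) = uniform_prob (@ltr01 R) A
      & forall u v : R, mu (`]-oo, u] `*` `]-oo, v]) = (C u v)%:E]].

Definition Linfty_cont d (T : measurableType d) (R : realType)
    (P : probability T R) (X : {RV P >-> R}) : Prop :=
  (X : T -> R) \in Lfun P +oo%E /\ continuous (cdf X).

Definition eq_in_law d (T : measurableType d) (R : realType)
    (P : probability T R) (X Y : {RV P >-> R}) : Prop :=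
  forall A : set R, measurable A -> distribution P X A = distribution P Y A.

(* Sklar's relation; it determines the copula C uniquely when X and Y have
   continuous distributions. *)
Definition copula_of d (T : measurableType d) (R : realType)
    (P : probability T R) (C : R -> R -> R) (X Y : {RV P >-> R}) : Prop :=
  forall x y : R,
    P [set t | X t <= x /\ Y t <= y] =
    (C (fine (cdf X x)) (fine (cdf Y y)))%:E.

Definition cvg_in_probability d (T : measurableType d) (R : realType)
    (P : probability T R) (Z : nat -> T -> R) (Y : T -> R) : Prop :=
  forall e : R, 0 < e ->
    P [set t | e < `|Z n t - Y t|] @[n --> \oo] --> 0%E.

(* Sequences are indexed from 0: the first random variable is X 0. *)
Definition seq_coupled d (T : measurableType d) (R : realType)
    (P : probability T R) (C : R -> R -> R) (X : nat -> {RV P >-> R}) : Prop :=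
  forall n : nat, eq_in_law (X n) (X n.+1) /\ copula_of C (X n) (X n.+1).

Definition non_diversifiable d (T : measurableType d) (R : realType)
    (P : probability T R) (C : R -> R -> R) : Prop :=
  forall X : nat -> {RV P >-> R},
    (forall n, Linfty_cont (X n)) -> seq_coupled C X ->
    ~ cvg_in_probability P
        (fun n t => n.+1%:R^-1 * (\sum_(i < n.+1) X i t) - fine 'E_P[X 0%N])
        (cst 0).

Record bivariate_concentration_class d (T : measurableType d) (R : realType)
    (P : probability T R) (D : set (R -> R -> R)) : Prop := {
  bcc_copula : D `<=` @copula2 R ;
  bcc_ND : forall C, D C -> non_diversifiable P C ;
  bcc_DM : forall C C', D C -> copula2 C' ->
    (forall u v, C u v <= C' u v) -> D C' ;
  bcc_Cx : forall (C : nat -> R -> R -> R) (lam : nat -> R),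
    (forall n, D (C n)) -> (forall n, 0 <= lam n) ->
    series lam @ \oo --> (1 : R) ->
    D (fun u v => limn (series (fun n => lam n * C n u v)))
}.

Definition maximal_concentration_class d (T : measurableType d) (R : realType)
    (P : probability T R) (D : set (R -> R -> R)) : Prop :=
  bivariate_concentration_class P D /\
  ~ exists D' : set (R -> R -> R),
      [/\ bivariate_concentration_class P D', D' <> D & D `<=` D'].

Definition Dclass (R : realType) (p : R) : set (R -> R -> R) :=
  [set C | copula2 C /\ C p p = p].

(* Main.v *)
Require Import Defs.
From HB Require Import structures.
From mathcomp Require Import all_boot all_order all_algebra.
From mathcomp Require Import all_classical all_reals all_analysis.
From mathcomp Require Import measurable_realfun ess_sup_inf ring lra.

(* If C(p, p) = p then, for q with F(q) = p, the events {X_n <= q} of a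
   sequentially C-coupled sequence coincide almost surely. The averages thus have
   a constant mean on {X_0 <= q}, strictly below p E[X_0], which rules out
   convergence; so D_p is a concentration class.

   Conversely, let a class D be contained in no D_p. Each p in (0, 1) has a C in D
   with C(p, p) < p, an open condition, so a countable mixture gives one C in D
   with C(p, p) < p for all p in (0, 1). With delta(p) = p - C(p, p), run the
   Metropolis chain reversible for the uniform law that proposes a uniform point t
   from s and accepts it with probability min(delta(s), delta(t)) - |s - t|.
   As delta is 1-Lipschitz, the copula C' of one step lies above C, hence in D.
   If h_n(u) is the mean of phi(U_n) given U_0 = u, then the norms |h_n|_2
   decrease, and the decrements dominate the oscillation of h_n on small intervals;
   gluing intervals shows that h_n tends to the mean of phi. So correlations
   vanish, the averages converge, and C' is diversifiable: a contradiction.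
   Hence every class lies in some D_p; as no D_p lies in another D_q, the maximal
   classes are exactly the D_p.

   The chain is realised on the atomless space by iterating a measure-preserving
   skew product of [0, 1]^2, whose second coordinate supplies fresh noise. *)

Set Implicit Arguments.
Unset Strict Implicit.
Unset Printing Implicit Defensive.

Import Order.TTheory GRing.Theory Num.Theory.
Import numFieldNormedType.Exports.

Local Open Scope classical_set_scope.
Local Open Scope ring_scope.

(** * Integrals of bounded measurable functions *)

(** The gap $\delta$ vanishes at 0 and 1 and acceptance stops once $|s-t|$ is large, so acceptance
    is bounded below only near interior points of the diagonal, with constants that degenerate at
    the ends. No rate of mixing is sought: convergence of the energies $|h_n|_2^2$ suffices. Their
    decrement is the mean of $(h_n(U_1)-h_{n+1}(U_0))^2$, a conditional variance; where acceptance
    is at least $r$ it controls $h_{n+1}(u)-h_n(v)$ for independent $u$ and $v$, since the proposal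
    is independent of the state. Passing through a third point removes the mismatch between $n$ and
    $n+1$, and the connectedness of $(0,1)$ carries local constancy to every $[r,1-r]$.

    Only the diagonal of $C$ enters the chain. The term $|s-t|$ in the acceptance probability pays
    for the comparison of $C'$ with $C$ off the diagonal.

    All integrands are bounded and measurable on probability spaces, so that integrability is
    automatic and Fubini's theorem applies freely. *)

Definition bounded_meas d (T : measurableType d) (R : realType) (f : T -> R) :=
  measurable_fun setT f /\ exists M, forall x, `|f x| <= M.

Section bounded_measurable.
Context d (T : measurableType d) (R : realType).
Implicit Types (f g : T -> R).

Lemma bm_meas f : bounded_meas f -> measurable_fun setT f.
Proof. by case. Qed.

Lemma bm_cst (r : R) : bounded_meas (fun _ : T => r).
Proof. by split; [exact: measurable_cst|exists `|r|]. Qed.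

Lemma bmD f g : bounded_meas f -> bounded_meas g ->
  bounded_meas (fun x => f x + g x).
Proof.
move=> [mf [M fM]] [mg [N gN]]; split; first exact: measurable_funD.
by exists (M + N) => x; rewrite (le_trans (ler_normD _ _))// lerD.
Qed.

Lemma bmM f g : bounded_meas f -> bounded_meas g ->
  bounded_meas (fun x => f x * g x).
Proof.
move=> [mf [M fM]] [mg [N gN]]; split; first exact: measurable_funM.
by exists (M * N) => x; rewrite normrM ler_pM.
Qed.

Lemma bmN f : bounded_meas f -> bounded_meas (fun x => - f x).
Proof.
move=> [mf [M fM]]; split; first exact: measurableT_comp.
by exists M => x; rewrite normrN.
Qed.

Lemma bmB f g : bounded_meas f -> bounded_meas g ->
  bounded_meas (fun x => f x - g x).
Proof. by move=> hf hg; apply: bmD => //; exact: bmN. Qed.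

Lemma bm_norm f : bounded_meas f -> bounded_meas (fun x => `|f x|).
Proof.
move=> [mf [M fM]]; split; first exact: measurableT_comp.
by exists M => x; rewrite normr_id.
Qed.

Lemma bm_sqr f : bounded_meas f -> bounded_meas (fun x => f x ^+ 2).
Proof. by move=> hf; under eq_fun do rewrite expr2; exact: bmM. Qed.

Lemma bm_indic (A : set T) : measurable A -> bounded_meas (\1_A : T -> R).
Proof.
move=> mA; split; first exact: measurable_indic.
by exists 1 => x; rewrite indicE; case: (_ \in _); rewrite /= ?normr1 ?normr0.
Qed.

Lemma bm_sum (I : Type) (s : seq I) (F : I -> T -> R) :
  (forall i, bounded_meas (F i)) -> bounded_meas (fun x => \sum_(i <- s) F i x).
Proof.
move=> bF; elim: s => [|i s IH].
  by under eq_fun do rewrite big_nil; exact: bm_cst.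
by under eq_fun do rewrite big_cons; exact: bmD.
Qed.

Lemma bm_comp d' (T' : measurableType d') (h : T' -> T) f :
  measurable_fun setT h -> bounded_meas f -> bounded_meas (fun x => f (h x)).
Proof.
move=> mh [mf [M fM]]; split; first exact: measurableT_comp.
by exists M.
Qed.

Variable mu : probability T R.

Lemma bm_integrable f : bounded_meas f -> mu.-integrable setT (EFin \o f).
Proof.
move=> [mf [M fM]]; apply: measurable_bounded_integrable => //.
  by rewrite [ltLHS]probability_setT ltry.
by exists M; split; rewrite ?num_real// => N MN x _; exact: le_trans (fM x) (ltW MN).
Qed.



Lemma bm_intE f : bounded_meas f -> (\int[mu]_x (f x)%:E = (\int[mu]_x f x)%:E)%E.
Proof.
move=> hf; rewrite /Rintegral fineK//.
exact: (integrable_fin_num measurableT (bm_integrable hf)).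
Qed.

Lemma bm_intD f g : bounded_meas f -> bounded_meas g ->
  \int[mu]_x (f x + g x) = \int[mu]_x f x + \int[mu]_x g x.
Proof. by move=> hf hg; rewrite RintegralD//; exact: bm_integrable. Qed.

Lemma bm_intB f g : bounded_meas f -> bounded_meas g ->
  \int[mu]_x (f x - g x) = \int[mu]_x f x - \int[mu]_x g x.
Proof. by move=> hf hg; rewrite RintegralB//; exact: bm_integrable. Qed.

Lemma bm_intZ f r : bounded_meas f ->
  \int[mu]_x (r * f x) = r * \int[mu]_x f x.
Proof. by move=> hf; rewrite RintegralZl//; exact: bm_integrable. Qed.

Lemma bm_int_le f g : bounded_meas f -> bounded_meas g ->
  (forall x, f x <= g x) -> \int[mu]_x f x <= \int[mu]_x g x.
Proof.
by move=> hf hg fg; apply: le_Rintegral => //; exact: bm_integrable.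
Qed.

Lemma bm_int_ge0 f : (forall x, 0 <= f x) -> 0 <= \int[mu]_x f x.
Proof. by move=> f0; apply: Rintegral_ge0 => x _. Qed.

Lemma int_cst r : \int[mu]_x r = r.
Proof.
by rewrite Rintegral_cst// [X in fine X]probability_setT/= mulr1.
Qed.

Lemma bm_int_abs f : bounded_meas f -> `|\int[mu]_x f x| <= \int[mu]_x `|f x|.
Proof. by move=> hf; apply: le_normr_Rintegral => //; exact: bm_integrable. Qed.

Lemma bm_int_indic (A : set T) : measurable A ->
  (mu A = (\int[mu]_x (\1_A x))%:E)%E.
Proof.
move=> mA; rewrite -bm_intE; last exact: bm_indic.
by rewrite integral_indic// setIT.
Qed.

Lemma bm_int_sum (I : Type) (s : seq I) (F : I -> T -> R) :
  (forall i, bounded_meas (F i)) ->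
  \int[mu]_x (\sum_(i <- s) F i x) = \sum_(i <- s) \int[mu]_x (F i x).
Proof.
move=> bF; elim: s => [|i s IH].
  by rewrite big_nil; under eq_Rintegral do rewrite big_nil; rewrite int_cst.
rewrite big_cons -IH -bm_intD//; last exact: bm_sum.
by apply: eq_Rintegral => x _; rewrite big_cons.
Qed.

(** The variance of [f] is nonnegative. *)
Lemma bm_int_sqr_le f : bounded_meas f ->
  (\int[mu]_x f x) ^+ 2 <= \int[mu]_x (f x ^+ 2).
Proof.
move=> hf; set m := \int[mu]_x f x.
have : 0 <= \int[mu]_x ((f x - m) ^+ 2) by apply: bm_int_ge0 => x; exact: sqr_ge0.
have -> : \int[mu]_x ((f x - m) ^+ 2)
    = \int[mu]_x ((f x ^+ 2 + (- 2 * m) * f x) + m ^+ 2).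
  by apply: eq_Rintegral => x _; ring.
have b1 := bm_sqr hf; have b2 := bmM (bm_cst (- 2 * m)) hf.
have b3 := bmD b1 b2; have b4 := bm_cst (m ^+ 2).
rewrite (bm_intD b3 b4) (bm_intD b1 b2) bm_intZ// int_cst -/m; lra.
Qed.

End bounded_measurable.

Section measure_preserving.
Context d1 d2 (T1 : measurableType d1) (T2 : measurableType d2) (R : realType).
Variables (m1 : probability T1 R) (m2 : probability T2 R) (h : T1 -> T2).

Definition meas_pres := measurable_fun setT h /\
  forall A, measurable A -> m1 (h @^-1` A) = m2 A.

Hypothesis mph : meas_pres.

Lemma bm_int_pres f : bounded_meas f ->
  \int[m1]_x (f (h x)) = \int[m2]_y (f y).
Proof.
move=> bf; have [mh Eh] := mph; rewrite /Rintegral; congr fine.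
have bfh := bm_comp mh bf.
rewrite -[LHS]/(\int[m1]_(x in h @^-1` setT) ((EFin \o f) \o h) x)%E.
rewrite -integral_pushforward//; last 2 first.
- by apply/measurable_EFinP; case: bf.
- exact: bm_integrable bfh.
apply: eq_measure_integral => A mA _; exact: Eh.
Qed.

End measure_preserving.

Section fubini.
Context d1 d2 (T1 : measurableType d1) (T2 : measurableType d2) (R : realType).
Variables (m1 : probability T1 R) (m2 : probability T2 R).

Definition mprod : probability (T1 * T2)%type R := (m1 \x m2)%E.

Lemma bm_pair1 (f : T1 * T2 -> R) x : bounded_meas f -> bounded_meas (fun y => f (x, y)).
Proof. by apply: bm_comp; exact: measurable_pair1. Qed.

Lemma bm_pair2 (f : T1 * T2 -> R) y : bounded_meas f -> bounded_meas (fun x => f (x, y)).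
Proof. by apply: bm_comp; exact: measurable_pair2. Qed.

Lemma bm_int2 (f : T1 * T2 -> R) : bounded_meas f ->
  bounded_meas (fun x => \int[m2]_y f (x, y)).
Proof.
move=> bf; have [mf [M fM]] := bf; split.
  apply/measurable_EFinP; apply: eq_measurable_fun
    (measurable_fubini_F (bm_integrable mprod bf)) => x _ /=.
  by rewrite /fubini_F -(bm_intE m2 (bm_pair1 x bf)).
exists M => x; apply: (le_trans (bm_int_abs m2 (bm_pair1 x bf))).
rewrite -[leRHS](int_cst m2); apply: bm_int_le => //.
- by apply: bm_norm; exact: bm_pair1.
- exact: bm_cst.
Qed.

Lemma bm_int1 (f : T1 * T2 -> R) : bounded_meas f ->
  bounded_meas (fun y => \int[m1]_x f (x, y)).
Proof.
move=> bf; have [mf [M fM]] := bf; split.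
  apply/measurable_EFinP; apply: eq_measurable_fun
    (measurable_fubini_G (bm_integrable mprod bf)) => x _ /=.
  by rewrite /fubini_G -(bm_intE m1 (bm_pair2 x bf)).
exists M => x; apply: (le_trans (bm_int_abs m1 (bm_pair2 x bf))).
rewrite -[leRHS](int_cst m1); apply: bm_int_le => //.
- by apply: bm_norm; exact: bm_pair2.
- exact: bm_cst.
Qed.

Lemma bm_fubini1 (f : T1 * T2 -> R) : bounded_meas f ->
  \int[mprod]_z f z = \int[m1]_x \int[m2]_y f (x, y).
Proof.
move=> bf; apply: EFin_inj; rewrite -bm_intE// -bm_intE; last exact: bm_int2.
rewrite -(integral12_prod_meas1 (bm_integrable mprod bf)).
by apply: eq_integral => x _; rewrite /fubini_F bm_intE//; exact: bm_pair1.
Qed.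

Lemma bm_fubini2 (f : T1 * T2 -> R) : bounded_meas f ->
  \int[mprod]_z f z = \int[m2]_y \int[m1]_x f (x, y).
Proof.
move=> bf; apply: EFin_inj; rewrite -bm_intE// -bm_intE; last exact: bm_int1.
rewrite -(integral21_prod_meas1 (bm_integrable mprod bf)).
by apply: eq_integral => x _; rewrite /fubini_G bm_intE//; exact: bm_pair2.
Qed.

End fubini.

(** * The Metropolis kernel *)

Lemma measurable_lt_fun d (T : measurableType d) (R : realType) (f g : T -> R) :
  measurable_fun setT f -> measurable_fun setT g ->
  measurable [set x | f x < g x].
Proof.
move=> mf mg; rewrite -[X in measurable X]setTI.
have -> : [set x | f x < g x] = (fun x => f x < g x) @^-1` [set true] by [].
exact: (measurable_fun_ltr mf mg).
Qed.

Ltac measurable_proj := solve [repeat first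
  [ exact: measurable_fst | exact: measurable_snd | exact: measurable_id
  | exact: measurable_cst | apply: measurable_fun_pair
  | apply: (measurableT_comp measurable_fst)
  | apply: (measurableT_comp measurable_snd) ]].

Section measure_preserving_int.
Context d1 d2 (T1 : measurableType d1) (T2 : measurableType d2) (R : realType).
Variables (m1 : probability T1 R) (m2 : probability T2 R) (h : T1 -> T2).

(** Invariance can thus be checked on integrals, where Fubini's theorem applies directly, instead of
    on preimages in product spaces. *)
Lemma meas_pres_int : measurable_fun setT h ->
  (forall f, bounded_meas f -> \int[m1]_x (f (h x)) = \int[m2]_y (f y)) ->
  meas_pres m1 m2 h.
Proof.
move=> mh H; split => // A mA.
have mhA : measurable (h @^-1` A) by rewrite -[X in measurable X]setTI; exact: mh.
rewrite !bm_int_indic//; congr (_%:E).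
by rewrite -(H _ (bm_indic R mA)).
Qed.

End measure_preserving_int.

Section metropolis.
Context d (T : measurableType d) (R : realType).
Variables (nu : probability T R) (la : probability R R).
Variable al : T * T -> R.
Hypothesis mal : measurable_fun setT al.
Hypothesis sal : forall u v, al (u, v) = al (v, u).

(** [p.1] is the state, [p.2.1] the proposal and [p.2.2] the noise deciding acceptance. When the
    noise is uniform on $[0,1]$, values of [al] outside $[0,1]$ act as the probabilities 0 and 1. *)
Definition metro (p : T * (T * R)) : T :=
  if p.2.2 < al (p.1, p.2.1) then p.2.1 else p.1.

Let acc : set (T * (T * R)) := [set p | p.2.2 < al (p.1, p.2.1)].

Let macc : measurable acc.
Proof.
by apply: measurable_lt_fun; [measurable_proj|apply: (measurableT_comp mal); measurable_proj].
Qed.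

Let indic_acc p : \1_acc p = (p.2.2 < al (p.1, p.2.1))%R%:R :> R.
Proof.
by rewrite indicE; congr ((nat_of_bool _)%:R); apply/idP/idP; rewrite inE.
Qed.

Lemma measurable_metro : measurable_fun setT metro.
Proof.
apply: measurable_fun_if => //.
- by apply: measurable_fun_ltr; [measurable_proj|apply: (measurableT_comp mal); measurable_proj].
- by apply: (measurable_funS measurableT) => //; measurable_proj.
- by apply: (measurable_funS measurableT) => //; measurable_proj.
Qed.

(* The mass moved from u to v is balanced by the mass moved from v to u. *)
Lemma metro_pres : meas_pres (mprod nu (mprod nu la)) nu metro.
Proof.
apply: meas_pres_int; first exact: measurable_metro.
move=> f bf.
(* [b] is the probability that a move from [q.1] to a proposed [q.2] is accepted. *)
pose b (q : T * T) : R := \int[la]_z (\1_acc (q.1, (q.2, z))).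
have bb : bounded_meas b.
  pose g (r : (T * T) * R) := \1_acc (r.1.1, (r.1.2, r.2)) : R.
  have bg : bounded_meas g.
    apply: (bm_comp (h := fun r : (T * T) * R => (r.1.1, (r.1.2, r.2))) _
      (bm_indic R macc)).
    measurable_proj.
  have -> : b = (fun q => \int[la]_z g (q, z)) by apply/funext => -[u v].
  exact: (bm_int2 (mprod nu nu) la bg).
pose g (q : T * T) := b q * (f q.2 - f q.1).
have bf1 := bm_comp measurable_fst bf; have bf2 := bm_comp measurable_snd bf.
have bg : bounded_meas g.
  by apply: bmM => //; apply: bmB; [exact: bf2|exact: bf1].
(* [g] is antisymmetric, so exchanging the order of integration shows that its integral is its own
   opposite. *)
have g0 : \int[mprod nu nu]_q g q = 0.
  have E : \int[mprod nu nu]_q g q = - \int[mprod nu nu]_q g q.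
    rewrite [LHS](bm_fubini1 nu nu bg) [in RHS](bm_fubini2 nu nu bg).
    rewrite -mulN1r -bm_intZ; last exact: bm_int1.
    apply: eq_Rintegral => u _; rewrite -bm_intZ; last exact: bm_pair2.
    apply: eq_Rintegral => v _; rewrite /g /=.
    have -> : b (v, u) = b (u, v).
      by apply: eq_Rintegral => z _; rewrite !indic_acc /= sal.
    by ring.
  by lra.
pose F (p : T * (T * R)) := \1_acc p * (f p.2.1 - f p.1) + f p.1.
have bF : bounded_meas F.
  apply: bmD; last exact: bm_comp measurable_fst bf.
  apply: bmM; first exact: (bm_indic R macc).
  apply: bmB; last exact: bm_comp measurable_fst bf.
  exact: bm_comp (measurableT_comp measurable_fst measurable_snd) bf.
transitivity (\int[mprod nu (mprod nu la)]_p F p).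
  apply: eq_Rintegral => -[u [v z]] _; rewrite /F /metro indic_acc /=.
  by case: ifPn => h /=; rewrite ?mul1r ?mul0r; ring.
rewrite bm_fubini1//.
transitivity (\int[nu]_u (\int[nu]_v (g (u, v)) + f u)).
  apply: eq_Rintegral => u _; rewrite bm_fubini1; last exact: bm_pair1.
  have bgu := bm_pair1 u bg.
  rewrite -[in RHS](int_cst nu (f u)) -bm_intD//; last exact: bm_cst.
  apply: eq_Rintegral => v _; rewrite /g /F /=.
  rewrite bm_intD; last 2 first.
  - apply: bmM; last exact: bm_cst.
    apply: (bm_comp _ (bm_indic R macc)).
    measurable_proj.
  - exact: bm_cst.
  rewrite int_cst; congr (_ + _); rewrite mulrC -bm_intZ.
    by apply: eq_Rintegral => z _; rewrite mulrC.
  apply: (bm_comp _ (bm_indic R macc)).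
  measurable_proj.
rewrite bm_intD//; last exact: (bm_int2 nu nu bg).
by rewrite -bm_fubini1// g0 add0r.
Qed.

End metropolis.

(** * Iterated random dynamics *)

Section meas_pres_theory.
Context d1 d2 d3 (T1 : measurableType d1) (T2 : measurableType d2)
  (T3 : measurableType d3) (R : realType).
Variables (m1 : probability T1 R) (m2 : probability T2 R) (m3 : probability T3 R).

Lemma meas_pres_comp (g : T2 -> T3) (f : T1 -> T2) :
  meas_pres m2 m3 g -> meas_pres m1 m2 f -> meas_pres m1 m3 (g \o f).
Proof.
move=> [mg Eg] [mf Ef]; split; first exact: measurableT_comp.
move=> A mA; rewrite comp_preimage Ef ?Eg//.
by rewrite -[X in measurable X]setTI; exact: mg.
Qed.

End meas_pres_theory.

Section random_dynamics.
Context dE dY dW (E : measurableType dE) (Y : measurableType dY)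
  (W : measurableType dW) (R : realType).
Variables (nu : probability E R) (la : probability Y R) (ka : probability W R).
Variables (rho : E * Y -> E) (th : W -> Y * W).
Hypothesis rho_pres : meas_pres (mprod nu la) nu rho.
Hypothesis th_pres : meas_pres ka (mprod la ka) th.

(** A single driving variable takes the place of an infinite sequence of independent noises. *)
Definition skew (p : E * W) : E * W := (rho (p.1, (th p.2).1), (th p.2).2).

Let mrho : measurable_fun setT rho := proj1 rho_pres.
Let mth : measurable_fun setT th := proj1 th_pres.

Lemma measurable_skew : measurable_fun setT skew.
Proof.
apply: measurable_fun_pair.
  apply: (measurableT_comp mrho); apply: measurable_fun_pair => //.
  apply: (measurableT_comp measurable_fst); exact: measurableT_comp.
apply: (measurableT_comp measurable_snd); exact: measurableT_comp.
Qed.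

(* Integrating out the driving variable first: [th] splits it into a fresh
   noise [y] and an independent driving variable for the future. *)
Lemma int_skew2 (F : E * W -> R) u : bounded_meas F ->
  \int[ka]_w F (skew (u, w)) = \int[la]_y \int[ka]_w F (rho (u, y), w).
Proof.
move=> bF.
have bG : bounded_meas (fun q : Y * W => F (rho (u, q.1), q.2)).
  apply: (bm_comp _ bF); apply: measurable_fun_pair => //.
  apply: (measurableT_comp mrho); apply: measurable_fun_pair => //.
transitivity (\int[mprod la ka]_q F (rho (u, q.1), q.2)).
  by rewrite -(bm_int_pres th_pres bG).
by rewrite bm_fubini1.
Qed.

Lemma skew_pres : meas_pres (mprod nu ka) (mprod nu ka) skew.
Proof.
apply: meas_pres_int; first exact: measurable_skew.
move=> F bF; have bFs := bm_comp measurable_skew bF.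
rewrite (bm_fubini1 nu ka bFs) (bm_fubini1 nu ka bF).
have bF2 := bm_int2 nu ka bF.
rewrite -(bm_int_pres rho_pres bF2) bm_fubini1.
  by apply: eq_Rintegral => u _; rewrite int_skew2.
exact: bm_comp bF2.
Qed.

Lemma iter_skew_pres n : meas_pres (mprod nu ka) (mprod nu ka) (iter n skew).
Proof.
elim: n => [|n IH]; first by split; [exact: measurable_id|].
exact: (meas_pres_comp skew_pres IH).
Qed.

Lemma measurable_iter_skew n : measurable_fun setT (fst \o iter n skew).
Proof. by apply: measurableT_comp => //; have [] := iter_skew_pres n. Qed.

Variable phi : E -> R.
Hypothesis bphi : bounded_meas phi.

(** This is $P^n\phi$ for the Markov operator $P$ of the chain. *)
Definition transition n u : R := \int[ka]_w phi (iter n skew (u, w)).1.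

Let bphin n : bounded_meas (fun p => phi (iter n skew p).1) :=
  bm_comp (measurable_iter_skew n) bphi.

Lemma bm_transition n : bounded_meas (transition n).
Proof. exact: (bm_int2 nu ka (bphin n)). Qed.

(** The Markov property at the first step: [th] leaves a driving variable for the future that is
    independent of the first noise. *)
Lemma transitionS n u : transition n.+1 u = \int[la]_y transition n (rho (u, y)).
Proof.
rewrite -(int_skew2 u (bphin n)); apply: eq_Rintegral => w _.
by rewrite iterSr.
Qed.

Let bm_tr_rho n : bounded_meas (fun p => transition n (rho p)) :=
  bm_comp mrho (bm_transition n).

Lemma int_transition n : \int[nu]_u transition n u = \int[nu]_u phi u.
Proof.
rewrite -(bm_fubini1 nu ka (bphin n)).
rewrite (bm_int_pres (iter_skew_pres n) (bm_comp measurable_fst bphi)).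
rewrite bm_fubini1; last exact: bm_comp measurable_fst bphi.
by apply: eq_Rintegral => u _; rewrite /= int_cst.
Qed.

(* The dissipated energy is the mean conditional variance of one step. *)
Lemma transition_dissipation n :
  \int[mprod nu la]_p (transition n (rho p) - transition n.+1 p.1) ^+ 2
  = \int[nu]_u (transition n u ^+ 2) - \int[nu]_u (transition n.+1 u ^+ 2).
Proof.
have b1 := bm_sqr (bm_tr_rho n).
have bS1 : bounded_meas (fun p : E * Y => transition n.+1 p.1) :=
  bm_comp measurable_fst (bm_transition n.+1).
rewrite -(bm_int_pres rho_pres (bm_sqr (bm_transition n))).
rewrite bm_fubini1; last by apply: bm_sqr; exact: bmB.
rewrite (bm_fubini1 _ _ b1) -bm_intB; last 2 first.
- exact: bm_int2 b1.
- exact/bm_sqr/bm_transition.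
apply: eq_Rintegral => u _; set s := transition n.+1 u.
have bu := bm_pair1 u (bm_tr_rho n); have bu2 := bm_sqr bu.
transitivity (\int[la]_y (transition n (rho (u, y)) ^+ 2 +
   ((- 2 * s) * transition n (rho (u, y)) + s ^+ 2))).
  by apply: eq_Rintegral => y _ /=; rewrite -/s; ring.
have b3 := bmM (bm_cst Y (- 2 * s)) bu.
rewrite (bm_intD _ bu2 (bmD b3 (bm_cst Y (s ^+ 2)))).
rewrite (bm_intD _ b3 (bm_cst Y (s ^+ 2))) bm_intZ// int_cst -transitionS -/s.
by ring.
Qed.

(** The energies decrease and are nonnegative, hence converge, and their consecutive differences
    vanish in the limit. *)
Lemma cvg_dissipation :
  (fun n => \int[mprod nu la]_p
     (transition n (rho p) - transition n.+1 p.1) ^+ 2) @ \oo --> 0.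
Proof.
pose e n := \int[nu]_u (transition n u ^+ 2).
have De n : \int[mprod nu la]_p (transition n (rho p) - transition n.+1 p.1) ^+ 2
    = e n - e n.+1 by exact: transition_dissipation.
under eq_fun do rewrite De.
have ce : cvgn e.
  apply: nonincreasing_is_cvgn.
    apply/nonincreasing_seqP => n; rewrite -subr_ge0 -De.
    by apply: bm_int_ge0 => p; exact: sqr_ge0.
  by exists 0 => _ [n _ <-]; apply: bm_int_ge0 => u; exact: sqr_ge0.
have ce' : (fun n => e n.+1) @ \oo --> limn e by rewrite (cvg_shiftS e).
by rewrite -(subrr (limn e)); exact: (cvgB ce ce').
Qed.

(** By invariance under [skew], both times can be shifted back by [i]. *)
Lemma correlation i k :
  \int[mprod nu ka]_p (phi (iter i skew p).1 * phi (iter (i + k) skew p).1)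
  = \int[nu]_u (phi u * transition k u).
Proof.
pose G (p : E * W) := phi p.1 * phi (iter k skew p).1.
have bG : bounded_meas G by apply: bmM (bphin k); exact: bm_comp bphi.
transitivity (\int[mprod nu ka]_p (G (iter i skew p))).
  by apply: eq_Rintegral => p _; rewrite /G -iterD addnC.
rewrite (bm_int_pres (iter_skew_pres i) bG) bm_fubini1//.
apply: eq_Rintegral => u _; rewrite /G /= bm_intZ//.
exact: bm_pair1 (bphin k).
Qed.

Let c k := \int[nu]_u (phi u * transition k u).
Let birkhoff n p : R := \sum_(i < n) phi (iter i skew p).1.

Let bbirkhoff n : bounded_meas (birkhoff n).
Proof. by apply: bm_sum => i. Qed.

Lemma birkhoff_sqr n :
  \int[mprod nu ka]_p (birkhoff n.+1 p) ^+ 2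
  = \int[mprod nu ka]_p (birkhoff n p) ^+ 2 + (2 * \sum_(i < n) c i.+1 + c 0).
Proof.
pose f i p := phi (@iter (E * W) i skew p).1.
have bf i : bounded_meas (f i) by exact: bphin.
have b2 := bm_sqr (bbirkhoff n).
have b3 : bounded_meas (fun p => \sum_(i < n) f i p * f n p).
  by apply: bm_sum => i; exact: bmM.
have b4 := bmM (bm_cst (E * W)%type 2) b3.
have b5 := bmM (bf n) (bf n).
transitivity (\int[mprod nu ka]_p (birkhoff n p ^+ 2 +
    (2 * (\sum_(i < n) f i p * f n p) + f n p * f n p))).
  apply: eq_Rintegral => p _; rewrite /birkhoff big_ord_recr /= -/(f n p).
  by rewrite -mulr_suml; ring.
rewrite (bm_intD _ b2 (bmD b4 b5)) (bm_intD _ b4 b5) bm_intZ//.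
congr (_ + (2 * _ + _)).
  rewrite bm_int_sum; last by move=> i; exact: bmM.
  (* The term of index [i] has lag [n - i]; reversing the sum turns the lag into [i.+1]. *)
  rewrite (reindex_inj rev_ord_inj) /=; apply: eq_bigr => i _.
  rewrite -/(c i.+1) /c -(correlation (n - i.+1) i.+1) /f.
  by apply: eq_Rintegral => p _; rewrite subnK.
by rewrite /c -(correlation n 0) addn0.
Qed.

(** The second moment of a sum of [n] terms is at most [n] times a partial sum of absolute
    correlations. Division by the square of [n] leaves a Cesàro mean of correlations, which tends to
    0 with them. *)
Lemma mean_ergodic : c @ \oo --> 0 ->
  (fun n => \int[mprod nu ka]_p (n.+1%:R^-1 * birkhoff n.+1 p) ^+ 2) @ \oo --> 0.
Proof.
move=> c0.
have Bn n : \int[mprod nu ka]_p (birkhoff n p) ^+ 2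
    <= n%:R * (2 * \sum_(i < n) `|c i.+1| + `|c 0|).
  elim: n => [|n IH].
    rewrite mul0r; under eq_Rintegral do rewrite /birkhoff big_ord0 expr0n /=.
    by rewrite int_cst.
  rewrite birkhoff_sqr -[n.+1%:R]natr1 [(n%:R + 1) * _]mulrDl mul1r; apply: lerD.
    apply: (le_trans IH); apply: ler_wpM2l => //.
    by rewrite lerD2r ler_wpM2l// big_ord_recr /= lerDl.
  apply: lerD; last exact: ler_norm.
  rewrite ler_wpM2l// big_ord_recr /=.
  by apply: ler_wpDr => //; apply: ler_sum => i _; exact: ler_norm.
have cn0 : (fun n => `|c n.+1|) @ \oo --> (0 : R).
  rewrite -(normr0 R); apply: cvg_norm.
  by rewrite (cvg_shiftS c).
have ces := cesaro cn0.
pose B n := 2 * arithmetic_mean (fun n => `|c n.+1|) n + `|c 0| * n.+1%:R^-1 : R.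
apply: (@squeeze_cvgr _ _ _ _ (fun=> 0) B).
- apply: nearW => n; apply/andP; split; first by apply: bm_int_ge0 => p; exact: sqr_ge0.
  under eq_Rintegral do rewrite exprMn.
  rewrite bm_intZ; last exact: bm_sqr.
  apply: (@le_trans _ _ (n.+1%:R^-1 ^+ 2 *
      (n.+1%:R * (2 * \sum_(i < n.+1) `|c i.+1| + `|c 0|)))).
    by rewrite ler_wpM2l// sqr_ge0.
  rewrite /B /arithmetic_mean /= seriesEord /=.
  rewrite le_eqVlt; apply/orP; left; apply/eqP.
  set S := \sum_(i < n.+1) _; set a := `|c 0|; set x : R := n.+1%:R.
  have x0 : x != 0 by rewrite pnatr_eq0.
  by field.
- exact: cvg_cst.
- rewrite [X in _ --> X](_ : 0 = 2 * 0 + `|c 0| * 0 :> R); last by rewrite !mulr0 addr0.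
  apply: cvgD; apply: cvgMr => //; exact: cvg_harmonic.
Qed.

End random_dynamics.

(** * The uniform law *)

Section uniform.
Context (R : realType).

(* The measurable space on which [uniform_prob] is declared a probability does
   not unify with the canonical one of [R]; [unif] is the same set function,
   declared on the latter. *)
Definition unif_fun (A : set R) : \bar R := uniform_prob (@ltr01 R) A.

Let unif_fun0 : unif_fun set0 = 0%E. Proof. exact: measure0. Qed.

Let unif_fun_ge0 A : (0 <= unif_fun A)%E. Proof. exact: measure_ge0. Qed.

Let unif_fun_sigma_additive : semi_sigma_additive unif_fun.
Proof. exact: (@measure_semi_sigma_additive _ _ _ (uniform_prob (@ltr01 R))). Qed.

HB.instance Definition _ := isMeasure.Build _ _ _ unif_fun
  unif_fun0 unif_fun_ge0 unif_fun_sigma_additive.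

Let unif_funT : unif_fun setT = 1%E.
Proof. exact: (@probability_setT _ _ _ (uniform_prob (@ltr01 R))). Qed.

HB.instance Definition _ := @Measure_isProbability.Build _ _ R unif_fun unif_funT.

Definition unif : probability R R := unif_fun.

Lemma unifE A : unif A = uniform_prob (@ltr01 R) A. Proof. by []. Qed.

(** It serves also as the distribution function of the uniform law, and as the identity on $[0,1]$
    made bounded on the line. *)
Definition clamp (x : R) := Num.max 0 (Num.min x 1).

Lemma clamp_ge0 x : 0 <= clamp x.
Proof. by rewrite /clamp le_max lexx. Qed.

Lemma clamp_le1 x : clamp x <= 1.
Proof. by rewrite /clamp ge_max ler01 ge_min lexx orbT. Qed.

Lemma clamp_id x : 0 <= x <= 1 -> clamp x = x.
Proof. by move=> /andP[x0 x1]; rewrite /clamp (min_idPl x1) (max_idPr x0). Qed.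

Lemma clamp_le x y : x <= y -> clamp x <= clamp y.
Proof.
move=> xy; rewrite /clamp ge_max le_max lexx /= le_max le_min !ge_min xy lexx.
by rewrite orbT orbT.
Qed.

Lemma clamp_lip x y : x <= y -> clamp y - clamp x <= y - x.
Proof.
move=> xy; rewrite /clamp /Num.max /Num.min.
by case: (ltP y 1) => ?; case: (ltP x 1) => ?; repeat case: ltP => ?; lra.
Qed.

Lemma unif_itvNyc x : unif `]-oo, x]%classic = (clamp x)%:E.
Proof.
rewrite unifE /uniform_prob integral_uniform_pdf.
rewrite (eq_integral (fun=> 1%E)); last first.
  move=> y; rewrite inE /= => -[_]; rewrite in_itv /= /uniform_pdf => ->.
  by rewrite subr0 invr1.
rewrite integral_cst/= ?mul1e; last exact: measurableI.
have [x0|x0] := ltP x 0.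
  rewrite (_ : _ `&` _ = set0) ?measure0; last first.
    rewrite -subset0 => y [] /=; rewrite !in_itv /= => yx /andP[y0 _].
    by have := le_lt_trans (le_trans y0 yx) x0; rewrite ltxx.
  by rewrite /clamp min_l ?max_l// ltW// (lt_trans x0).
rewrite (_ : _ `&` _ = `[0, Num.min x 1]%classic); last first.
  apply/seteqP; split => y /=; rewrite !in_itv /=.
    by move=> [yx /andP[-> y1]]; rewrite le_min yx.
  by rewrite le_min => /and3P[-> -> ->].
rewrite lebesgue_measure_itv /= lte_fin /clamp.
have m0 : 0 <= Num.min x 1 by rewrite le_min x0 ler01.
rewrite (max_r m0); case: ltP => h; rewrite -?EFinB ?subr0//.
by congr (_%:E); apply/eqP; rewrite eq_le m0 h.
Qed.

Lemma unif_set1 x : unif [set x] = 0%E.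
Proof.
have := @dominates_uniform_prob R 0 1 ltr01.
move=> /null_content_dominatesP; apply; [exact: measurable_set1|exact: lebesgue_measure_set1].
Qed.

Lemma unif_itvoc x y : x <= y -> unif `]x, y]%classic = (clamp y - clamp x)%:E.
Proof.
move=> xy; have -> : `]x, y]%classic = `]-oo, y]%classic `\` `]-oo, x]%classic :> set R.
  apply/seteqP; split => z /=; rewrite !in_itv /=.
    by move=> /andP[xz ->]; split => //; apply/negP; rewrite -ltNge.
  by move=> [-> /negP]; rewrite -ltNge => ->.
rewrite measureD//; last by rewrite [X in (X < _)%E]unif_itvNyc ltry.
rewrite setIidr; last by apply: subset_itvl; rewrite bnd_simp.
by rewrite [X in (X - _)%E]unif_itvNyc [X in (_ - X)%E]unif_itvNyc.
Qed.

Lemma unif_itvNyo x : unif `]-oo, x[%classic = (clamp x)%:E.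
Proof.
rewrite -unif_itvNyc -(@setUitv1 _ _ _ _ true)// measureU//.
  by rewrite [X in (_ + X)%E]unif_set1 adde0.
by rewrite -subset0 => z [] /= /[swap] -> /=; rewrite in_itv /= ltxx.
Qed.

Lemma unif_itvcc x y : x <= y -> unif `[x, y]%classic = (clamp y - clamp x)%:E.
Proof.
move=> xy; rewrite -unif_itvoc// -(@setU1itv _ _ _ _ false) ?bnd_simp// measureU//.
  by rewrite [X in (X + _)%E]unif_set1 add0e.
by rewrite -subset0 => z [] /= ->; rewrite in_itv /= ltxx.
Qed.

End uniform.

(** * Mixing of the Metropolis chain *)

Section spread.
Context d (T : measurableType d) (R : realType) (nu : probability T R).
Implicit Types (f g h : T -> R) (A B O : set T).

(** A squared $L^2$ distance between [f] on [A] and [g] on [B], over independent points. Two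
    functions are allowed because a step of the chain compares [h n.+1] at the old state with [h n]
    at the new one; no local means occur, which keeps the gluing of sets elementary. *)
Definition spread_fun f g A B (p : T * T) : R :=
  \1_A p.1 * \1_B p.2 * (f p.1 - g p.2) ^+ 2.

Definition spread f g A B : R := \int[mprod nu nu]_p spread_fun f g A B p.

Lemma bm_spread f g A B : bounded_meas f -> bounded_meas g ->
  measurable A -> measurable B -> bounded_meas (spread_fun f g A B).
Proof.
move=> bf bg mA mB; apply: bmM.
  by apply: bmM; [exact: (bm_comp measurable_fst (bm_indic R mA))
                 |exact: (bm_comp measurable_snd (bm_indic R mB))].
by apply: bm_sqr; apply: bmB;
  [exact: (bm_comp measurable_fst bf)|exact: (bm_comp measurable_snd bg)].
Qed.

Lemma spread_fun_ge0 f g A B p : 0 <= spread_fun f g A B p.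
Proof. by rewrite /spread_fun mulr_ge0// ?sqr_ge0// mulr_ge0// indicE. Qed.

Lemma spread_ge0 f g A B : 0 <= spread f g A B.
Proof. by apply: bm_int_ge0 => p; exact: spread_fun_ge0. Qed.

Lemma bm_int_swap (F : T * T -> R) : bounded_meas F ->
  \int[mprod nu nu]_p F p = \int[mprod nu nu]_p F (p.2, p.1).
Proof.
move=> bF; have bF' : bounded_meas (fun p : T * T => F (p.2, p.1)).
  by apply: (bm_comp (h := fun p : T * T => (p.2, p.1)) _ bF); measurable_proj.
by rewrite (bm_fubini1 _ _ bF) (bm_fubini2 _ _ bF').
Qed.

Lemma spreadC f g A B : bounded_meas f -> bounded_meas g ->
  measurable A -> measurable B -> spread f g A B = spread g f B A.
Proof.
move=> bf bg mA mB; rewrite /spread bm_int_swap; last exact: bm_spread.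
by apply: eq_Rintegral => p _; rewrite /spread_fun /=; ring.
Qed.

Lemma le_indic A B (x : T) : A `<=` B -> \1_A x <= \1_B x :> R.
Proof.
move=> AB; rewrite !indicE ler_nat; case: (boolP (x \in A)) => //.
by rewrite inE => /AB; rewrite -inE => ->.
Qed.

Lemma spread_le f g A B A' B' : bounded_meas f -> bounded_meas g ->
  measurable A -> measurable B -> measurable A' -> measurable B' ->
  A `<=` A' -> B `<=` B' -> spread f g A B <= spread f g A' B'.
Proof.
move=> bf bg mA mB mA' mB' AA BB; apply: bm_int_le; try exact: bm_spread.
move=> p; rewrite /spread_fun ler_wpM2r ?sqr_ge0// ler_pM ?indicE//;
  by rewrite -!indicE; exact: le_indic.
Qed.

(* Both [f u] and [g v] are compared with [h w] for a third point [w] of [O]. *)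
Lemma spread_glue f g h A B O : bounded_meas f -> bounded_meas g ->
  bounded_meas h -> measurable A -> measurable B -> measurable O ->
  \int[nu]_w (\1_O w) * spread f g A B
  <= 2 * spread f h A O + 2 * spread h g O B.
Proof.
move=> bf bg bh mA mB mO.
have bA := bm_indic R mA; have bB := bm_indic R mB; have bO := bm_indic R mO.
have bfg := bm_spread bf bg mA mB; have bfh := bm_spread bf bh mA mO.
have bhg := bm_spread bh bg mO mB.
pose I1 u := \int[nu]_w spread_fun f h A O (u, w).
pose I2 v := \int[nu]_w spread_fun h g O B (w, v).
have bI1 : bounded_meas I1 := bm_int2 nu nu bfh.
have bI2 : bounded_meas I2 := bm_int1 nu nu bhg.
have -> : spread f h A O = \int[mprod nu nu]_p I1 p.1.
  rewrite bm_fubini1; last exact: (bm_comp measurable_fst bI1).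
  rewrite /spread (bm_fubini1 _ _ bfh).
  by apply: eq_Rintegral => u _; rewrite /= int_cst.
have -> : spread h g O B = \int[mprod nu nu]_p I2 p.2.
  rewrite bm_fubini2; last exact: (bm_comp measurable_snd bI2).
  rewrite /spread (bm_fubini2 _ _ bhg).
  by apply: eq_Rintegral => u _; rewrite /= int_cst.
have e1 := bm_comp (@measurable_fst _ _ T T) bI1.
have e2 := bm_comp (@measurable_snd _ _ T T) bI2.
have c1 := bmM (bm_cst (T * T)%type 2) e1.
have c2 := bmM (bm_cst (T * T)%type 2) e2.
rewrite /spread -(bm_intZ _ _ bfg) -(bm_intZ _ _ e1) -(bm_intZ _ _ e2).
rewrite -(bm_intD _ c1 c2); apply: bm_int_le.
- by apply: bmM => //; exact: bm_cst.
- exact: bmD.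
move=> [u v] /=; rewrite mulrC -(bm_intZ _ _ bO).
have d1 := bm_pair1 u bfh; have d2 := bm_pair2 v bhg.
rewrite /I1 /I2 -(bm_intZ _ _ d1) -(bm_intZ _ _ d2).
rewrite -(bm_intD _ (bmM (bm_cst T 2) d1) (bmM (bm_cst T 2) d2)).
apply: bm_int_le.
- by apply: bmM => //; exact: bm_cst.
- by apply: bmD; [exact: (bmM (bm_cst T 2) d1)|exact: (bmM (bm_cst T 2) d2)].
move=> w; rewrite /spread_fun /= !indicE.
case: (u \in A); case: (v \in B); case: (w \in O);
  rewrite /= ?mulr1 ?mul1r ?mulr0 ?mul0r ?mulr0 ?addr0 ?add0r//;
  do ?[by rewrite mulr_ge0// sqr_ge0].
(* This is $(x+y)^2\le 2x^2+2y^2$ with $x=f(u)-h(w)$ and $y=h(w)-g(v)$. *)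
have := sqr_ge0 (f u - h w - (h w - g v)).
rewrite -subr_ge0 => H; rewrite -subr_ge0; apply: le_trans H _; lra.
Qed.

(** $1_{A\cup B}\le 1_A+1_B$ in each coordinate, and the two mixed terms agree by symmetry. *)
Lemma spread_cup f A B : bounded_meas f -> measurable A -> measurable B ->
  spread f f (A `|` B) (A `|` B)
  <= spread f f A A + 2 * spread f f A B + spread f f B B.
Proof.
move=> bf mA mB; have mU := measurableU _ _ mA mB.
have b1 := bm_spread bf bf mA mA; have b2 := bm_spread bf bf mA mB.
have b3 := bm_spread bf bf mB mA; have b4 := bm_spread bf bf mB mB.
have -> : 2 * spread f f A B = spread f f A B + spread f f B A.
  by rewrite [in X in _ + X]spreadC//; ring.
rewrite /spread -(bm_intD _ b2 b3) -(bm_intD _ b1 (bmD b2 b3)).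
rewrite -(bm_intD _ (bmD b1 (bmD b2 b3)) b4).
apply: bm_int_le; first exact: bm_spread.
  exact: (bmD (bmD b1 (bmD b2 b3)) b4).
move=> [u v]; rewrite /spread_fun /= -!mulrDl ler_wpM2r ?sqr_ge0//.
rewrite !indicE !in_setU.
by case: (u \in A); case: (u \in B); case: (v \in A); case: (v \in B) => /=; lra.
Qed.

(** Off [A] times [A] one of the two coordinates lies outside [A], and there the squared difference
    is at most $4M^2$; the two coordinates give the factor 8. *)
Lemma spread_setT f A M : bounded_meas f -> measurable A ->
  (forall x, `|f x| <= M) ->
  spread f f setT setT <= spread f f A A
    + 8 * M ^+ 2 * \int[nu]_x (\1_(~` A) x).
Proof.
move=> bf mA fM; have mC := measurableC mA.
have bC := bm_indic R mC.
have bC1 := bm_comp (@measurable_fst _ _ T T) bC.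
have bC2 := bm_comp (@measurable_snd _ _ T T) bC.
pose G (p : T * T) : R := 4 * M ^+ 2 * (\1_(~` A) p.1 + \1_(~` A) p.2).
have bG : bounded_meas G by apply: bmM; [exact: bm_cst|exact: (bmD bC1 bC2)].
have -> : 8 * M ^+ 2 * \int[nu]_x (\1_(~` A) x) = \int[mprod nu nu]_p G p.
  rewrite bm_intZ; last exact: (bmD bC1 bC2).
  rewrite (bm_intD _ bC1 bC2) (bm_fubini2 _ _ bC1) (bm_fubini1 _ _ bC2).
  by rewrite /= !int_cst; ring.
have bAA := bm_spread bf bf mA mA.
rewrite /spread -(bm_intD _ bAA bG); apply: bm_int_le; first exact: bm_spread.
  exact: bmD.
move=> [u v]; rewrite /spread_fun /G /= !indicE !in_setT !in_setC /=.
have H : (f u - f v) ^+ 2 <= 4 * M ^+ 2.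
  have Hu := fM u; have Hv := fM v.
  have H1 : `|f u - f v| <= 2 * M by rewrite (le_trans (ler_normB _ _))//; lra.
  have M0 : 0 <= M by rewrite (le_trans (normr_ge0 _) Hu).
  rewrite -(real_normK (num_real (f u - f v))).
  rewrite (_ : 4 * M ^+ 2 = (2 * M) ^+ 2); last by ring.
  by rewrite lerXn2r// nnegrE mulr_ge0.
have := sqr_ge0 (f u - f v).
by case: (u \in A); case: (v \in A) => /=; lra.
Qed.

(** The cross term factorises into the square of the mean of [f]. *)
Lemma spread_variance f : bounded_meas f -> \int[nu]_x f x = 0 ->
  spread f f setT setT = 2 * \int[nu]_x (f x ^+ 2).
Proof.
move=> bf f0.
have b1 := bm_sqr (bm_comp (@measurable_fst _ _ T T) bf).
have b2 := bm_sqr (bm_comp (@measurable_snd _ _ T T) bf).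
have b3 : bounded_meas (fun p : T * T => f p.1 * f p.2).
  by apply: bmM; [exact: (bm_comp measurable_fst bf)|exact: (bm_comp measurable_snd bf)].
have b4 := bmM (bm_cst (T * T)%type (- 2)) b3.
transitivity (\int[mprod nu nu]_p ((f p.1 ^+ 2 + f p.2 ^+ 2) + - 2 * (f p.1 * f p.2))).
  by apply: eq_Rintegral => p _; rewrite /spread_fun !indicE !in_setT /=; ring.
rewrite (bm_intD _ (bmD b1 b2) b4) (bm_intD _ b1 b2) bm_intZ//.
rewrite (bm_fubini2 _ _ b1) (bm_fubini1 _ _ b2) (bm_fubini1 _ _ b3) /= !int_cst.
rewrite (_ : \int[nu]_x \int[nu]_y (f x * f y) = 0); first by ring.
rewrite -[RHS](int_cst nu); apply: eq_Rintegral => x _.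
by rewrite bm_intZ// f0 mulr0.
Qed.

End spread.

(* Overlapping good intervals merge, so local goodness propagates up to any
   compact interval: take the supremum of the reachable right end points. *)
Lemma interval_induction (R : realType) (G : R -> R -> Prop) :
  (forall a b a' b', a <= a' -> b' <= b -> G a b -> G a' b') ->
  (forall a b c e, 0 <= c -> b <= 1 -> a <= c -> c < b -> b <= e ->
    G a b -> G c e -> G a e) ->
  (forall p, 0 < p < 1 -> exists2 r, 0 < r & G (p - r) (p + r)) ->
  forall a b, 0 < a -> a < b -> b < 1 -> G a b.
Proof.
move=> mono glue loc a b a0 ab b1.
pose S := [set x | a < x <= b /\ G a x].
have a01 : 0 < a < 1 by rewrite a0 (lt_trans ab).
have [r r0 Gr] := loc _ a01.
have S0 : S !=set0.
  exists (Num.min (a + r) b); split.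
    by rewrite lt_min ab ltrDl r0 ge_min lexx orbT.
  apply: mono Gr; first by rewrite lerBlDr lerDl ltW.
  by rewrite ge_min lexx.
have Sub : ubound S b by move=> x [/andP[]].
have hS : has_sup S by split => //; exists b.
pose s := sup S.
have sb : s <= b by exact: ge_sup.
have as_ : a < s.
  by have [x Sx] := S0; have [/andP[ax _] _] := Sx; apply: (lt_le_trans ax);
    apply: ub_le_sup => //; exists b.
have s01 : 0 < s < 1 by rewrite (lt_trans a0 as_) (le_lt_trans sb).
have [q q0 Gq] := loc _ s01.
(* Some [x] of [S] exceeds [c], so [[a, x]] overlaps the good interval around [s] in [[c, x]], and
   goodness extends to [y]. Then [y] is in [S], hence at most [s], which leaves only [y = b]. *)
pose c := Num.max a (s - q).
have cs : c < s by rewrite gt_max as_ /= ltrBlDr ltrDl.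
have [x [/andP[ax xb] Gx] cx] : exists2 x, S x & c < x.
  have e0 : 0 < s - c by rewrite subr_gt0.
  by have [x Sx] := sup_adherent e0 hS; rewrite -/s subKr; exists x.
have xs : x <= s by apply: ub_le_sup; [exists b|split => //; rewrite ax].
pose y := Num.min (s + q) b.
have sy : s <= y by rewrite le_min sb lerDl ltW.
have xy : x <= y by exact: le_trans sy.
have Gy : G a y.
  apply: (glue a x c y) => //.
  - by rewrite le_max ltW.
  - by rewrite (le_trans xb)// ltW.
  - by rewrite le_max lexx.
  - by apply: mono Gq; [rewrite le_max lexx orbT|rewrite ge_min lexx].
have Sy : S y.
  by split => //; rewrite (lt_le_trans as_ sy) ge_min lexx orbT.
have ys : y <= s by apply: ub_le_sup => //; exists b.
suff : y = b by move=> <-.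
move: ys; rewrite /y ge_min; case: (ltP (s + q) b) => // h /orP[|] h'; lra.
Qed.

Lemma cvg0_bound (R : realType) (K : R) (u v : nat -> R) :
  (forall n, 0 <= u n <= K * v n) -> v @ \oo --> 0 -> u @ \oo --> 0.
Proof.
move=> uv v0; apply: (@squeeze_cvgr _ _ _ _ (fun=> 0) (fun n => K * v n)).
- exact: nearW.
- exact: cvg_cst.
- by rewrite -(mulr0 K); exact: cvgMr.
Qed.

Lemma int_unif_itvcc (R : realType) (a b : R) : 0 <= a -> a <= b -> b <= 1 ->
  \int[unif R]_x (\1_(`[a, b]%classic) x) = b - a.
Proof.
move=> a0 ab b1; apply: EFin_inj; rewrite -bm_int_indic// [LHS]unif_itvcc//.
by rewrite !clamp_id// ?a0 ?b1 ?andbT ?(le_trans ab)// (le_trans a0).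
Qed.

(** * Decay of correlations under a local lower bound on acceptance *)

Section mixing.
Context (R : realType).
Let nu := unif R.
Variable al : R * R -> R.
Hypothesis mal : measurable_fun setT al.
Hypothesis sal : forall u v, al (u, v) = al (v, u).
Hypothesis al_loc : forall p : R, 0 < p < 1 -> exists2 r : R, 0 < r &
  forall u v : R, p - r <= u <= p + r -> p - r <= v <= p + r -> r <= al (u, v).

Context dW (W : measurableType dW) (ka : probability W R).
Variable th : W -> (R * R) * W.
Hypothesis th_pres : meas_pres ka (mprod (mprod nu nu) ka) th.

Let rho_pres : meas_pres (mprod nu (mprod nu nu)) nu (metro al) :=
  metro_pres nu nu mal sal.

Variable phi : R -> R.
Hypothesis bphi : bounded_meas phi.
Hypothesis phi0 : \int[nu]_u phi u = 0.

Let h n := transition ka (metro al) th phi n.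

Let bh n : bounded_meas (h n) := bm_transition rho_pres th_pres bphi n.

(** If state and proposal lie in [J] and the noise is below [r], the proposal is accepted, so the
    dissipated quantity there is the integrand of the spread. The noise is independent of both
    points and contributes the factor [clamp r]. *)
Lemma spread_dissipation (J : set R) (r : R) n : measurable J ->
  (forall u v : R, J u -> J v -> r <= al (u, v)) ->
  clamp r * spread nu (h n.+1) (h n) J J <=
  \int[mprod nu (mprod nu nu)]_p (h n (metro al p) - h n.+1 p.1) ^+ 2.
Proof.
move=> mJ Jr; pose L := `]-oo, r[%classic : set R.
have mL : measurable L by exact: measurable_itv.
have bL := bm_indic R mL; have bs := bm_spread (bh n.+1) (bh n) mJ mJ.
pose H (p : R * (R * R)) := spread_fun (h n.+1) (h n) J J (p.1, p.2.1) * \1_L p.2.2.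
have bH : bounded_meas H.
  apply: bmM.
    by apply: (bm_comp (h := fun p : R * (R * R) => (p.1, p.2.1)) _ bs); measurable_proj.
  by apply: (bm_comp (h := fun p : R * (R * R) => p.2.2) _ bL); measurable_proj.
have -> : clamp r * spread nu (h n.+1) (h n) J J = \int[mprod nu (mprod nu nu)]_p H p.
  have EL : \int[nu]_z \1_L z = clamp r.
    by apply: EFin_inj; rewrite -bm_int_indic// [LHS]unif_itvNyo.
  have bcs := bmM (bm_cst (R * R)%type (clamp r)) bs.
  rewrite /spread -(bm_intZ _ _ bs) (bm_fubini1 _ _ bcs) (bm_fubini1 _ _ bH).
  apply: eq_Rintegral => u _; rewrite bm_fubini1; last exact: bm_pair1 bH.
  apply: eq_Rintegral => v _.
  by rewrite /H /= bm_intZ// EL mulrC.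
apply: bm_int_le => //.
  apply: bm_sqr; apply: bmB.
    exact: bm_comp (proj1 rho_pres) (bh n).
  exact: bm_comp measurable_fst (bh n.+1).
move=> [u [v z]]; rewrite /H /spread_fun !indicE /=.
case: (boolP (u \in J)) => uJ; last by rewrite !mul0r sqr_ge0.
case: (boolP (v \in J)) => vJ; last by rewrite mulr0 !mul0r sqr_ge0.
case: (boolP (z \in L)) => zL; last by rewrite mulr0 sqr_ge0.
move: uJ vJ zL; rewrite !inE /L /= in_itv /= => uJ vJ zL.
by rewrite /metro /= (lt_le_trans zL (Jr _ _ uJ vJ)) !mul1r mulr1 -sqrrN opprB.
Qed.

(** [h n] becomes constant on [[a, b]] in mean square; the constant may vary with [n]. *)
Let good a b := (fun n => spread nu (h n) (h n) `[a, b]%classic `[a, b]%classic)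
  @ \oo --> 0.

Let good_mono a b a' b' : a <= a' -> b' <= b -> good a b -> good a' b'.
Proof.
move=> aa bb; apply: (cvg0_bound (K := 1)) => n; rewrite spread_ge0 mul1r /=.
by apply: spread_le => // x /=; rewrite !in_itv /= => /andP[ax xb];
  rewrite (le_trans aa ax) (le_trans xb bb).
Qed.

(** Dissipation compares only [h n.+1] with [h n]. Gluing through the value of [h n.+1] at a third
    point of [J] compares [h n] with itself, at the cost of a factor 4 and of the measure of [J]. *)
Let good_loc p : 0 < p < 1 -> exists2 r, 0 < r & good (p - r) (p + r).
Proof.
move=> p01; have [r r0 Hr] := al_loc p01; have /andP[p0 p1] := p01.
(* The interval of radius [q] stays within $[0,1]$, so its uniform measure is exactly $2q$. *)
pose q := Num.min r (Num.min p (1 - p)).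
have q0 : 0 < q by rewrite !lt_min r0 p0 subr_gt0.
have qr : q <= r by rewrite ge_min lexx.
have qp : q <= p by rewrite !ge_min lexx orbT.
have q1 : q <= 1 - p by rewrite !ge_min lexx !orbT.
exists q => //; rewrite /good; set J := `[p - q, p + q]%classic.
have mJ : measurable J by exact: measurable_itv.
have J2 : \int[nu]_x (\1_J x) = 2 * q.
  by rewrite int_unif_itvcc; [ring|lra|lra|lra].
have Jal u v : J u -> J v -> r <= al (u, v).
  rewrite /J /= !in_itv /= => /andP[u1 u2] /andP[v1 v2].
  by apply: Hr; apply/andP; split; lra.
have c0 : 0 < clamp r.
  by rewrite /clamp lt_max lt_min r0 ltr01 orbT.
apply: (cvg0_bound (K := (2 * q)^-1 * (4 * (clamp r)^-1)) _
  (cvg_dissipation rho_pres th_pres bphi)) => n.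
rewrite spread_ge0 /= -mulrA ler_pdivlMl ?mulr_gt0// -J2.
apply: (le_trans (spread_glue nu (bh n) (bh n) (bh n.+1) mJ mJ mJ)).
rewrite [spread nu (h n) (h n.+1) J J]spreadC//.
have D := spread_dissipation n mJ Jal.
rewrite -mulrA [X in _ <= 4 * X](_ : _ = (clamp r)^-1 *
  \int[mprod nu (mprod nu nu)]_p (h n (metro al p) - h n.+1 p.1) ^+ 2)//.
have : spread nu (h n.+1) (h n) J J <= (clamp r)^-1 *
  \int[mprod nu (mprod nu nu)]_p (h n (metro al p) - h n.+1 p.1) ^+ 2.
  by rewrite ler_pdivlMl.
by move: (_^-1 * _) => X; lra.
Qed.

(** The mixed term over [A] and [B] passes through the overlap [O], which lies in both and has
    positive measure [b - c]. The factor 4 is the 2 of [spread_cup] times the 2 of [spread_glue]. *)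
Let good_glue a b c e : 0 <= c -> b <= 1 -> a <= c -> c < b -> b <= e ->
  good a b -> good c e -> good a e.
Proof.
move=> c0 b1 ac cb be ga gc.
set A := `[a, b]%classic : set R; set B := `[c, e]%classic : set R.
set O := `[c, b]%classic : set R.
have mA : measurable A by exact: measurable_itv.
have mB : measurable B by exact: measurable_itv.
have mO : measurable O by exact: measurable_itv.
have OA : O `<=` A.
  by move=> x; rewrite /O /A /= !in_itv /= => /andP[cx ->]; rewrite (le_trans ac cx).
have OB : O `<=` B.
  by move=> x; rewrite /O /B /= !in_itv /= => /andP[-> xb]; rewrite (le_trans xb be).
have EO : \int[nu]_x (\1_O x) = b - c by rewrite int_unif_itvcc// ltW.
apply: (cvg0_bound (K := 1 + 4 * (b - c)^-1)
  (v := fun n => spread nu (h n) (h n) A A + spread nu (h n) (h n) B B)); last first.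
  by rewrite -(addr0 0); apply: cvgD.
move=> n; rewrite spread_ge0 /=.
have U : `[a, e]%classic `<=` A `|` B.
  move=> x; rewrite /A /B /= !in_itv /= => /andP[ax xe].
  by have [xb|xb] := leP x b; [left|right]; rewrite ?ax// xe andbT ltW// (lt_trans cb).
have mU := measurableU _ _ mA mB.
have mae : measurable (`[a, e]%classic : set R) by exact: measurable_itv.
apply: (le_trans (spread_le nu (bh n) (bh n) mae mae mU mU U U)).
apply: (le_trans (spread_cup nu (bh n) mA mB)).
have S1 := spread_glue nu (bh n) (bh n) (bh n) mA mB mO.
have S2 := spread_le nu (bh n) (bh n) mA mO mA mA (@subset_refl _ A) OA.
have S3 := spread_le nu (bh n) (bh n) mO mB mB mB OB (@subset_refl _ B).
have bc : 0 < (b - c)^-1 by rewrite invr_gt0 subr_gt0.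
move: S1; rewrite EO -ler_pdivlMl ?subr_gt0// => S1.
have S4 := le_trans S1 (ler_wpM2l (ltW bc) (lerD (ler_wpM2l (ler0n _ 2) S2)
  (ler_wpM2l (ler0n _ 2) S3))).
move: S4 bc; move: (spread _ _ _ A A) (spread _ _ _ A B) (spread _ _ _ B B) (_^-1).
move=> x z y k; rewrite (_ : k * (2 * x + 2 * y) = 2 * (k * (x + y))); last by ring.
rewrite (_ : (1 + 4 * k) * (x + y) = x + y + 4 * (k * (x + y))); last by ring.
by move: (k * (x + y)) => X; lra.
Qed.

Lemma good_interval a b : 0 < a -> a < b -> b < 1 -> good a b.
Proof. exact: interval_induction. Qed.

Lemma transition_bound M n u : (forall x, `|phi x| <= M) -> `|h n u| <= M.
Proof.
move=> fM.
have b1 : bounded_meas (fun w => phi (iter n (skew (metro al) th) (u, w)).1).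
  apply: (@bm_pair1 _ _ _ _ _ (fun p => phi (iter n (skew (metro al) th) p).1)).
  exact: bm_comp (measurable_iter_skew rho_pres th_pres n) bphi.
apply: (le_trans (bm_int_abs ka b1)); rewrite -[leRHS](int_cst ka).
by apply: bm_int_le => //; [exact: bm_norm|exact: bm_cst].
Qed.

(** Since [h n] is centred, its spread over the whole space is twice its second moment. The spread
    over [[r, 1 - r]] vanishes in the limit, and the two end pieces have total mass $2r$. *)
Lemma cvg_transition_sqr : (fun n => \int[nu]_u (h n u ^+ 2)) @ \oo --> 0.
Proof.
have [M fM] := proj2 bphi.
have M0 : 0 <= M by exact: le_trans (normr_ge0 _) (fM 0).
have M1 : 0 < 1 + 16 * M ^+ 2.
  by rewrite ltr_wpDr// mulr_ge0// sqr_ge0.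
apply/cvgrPdist_lt => e e0.
(* The end pieces contribute at most $8M^2\cdot 2r\le e$. The summand 1 keeps the divisor positive
   when $M=0$, and the bound 1/4 makes [[r, 1 - r]] nondegenerate. *)
pose r := Num.min (4^-1) (e / (1 + 16 * M ^+ 2)) : R.
have r0 : 0 < r by rewrite lt_min invr_gt0 divr_gt0// ltr0n.
have r4 : r <= 4^-1 by rewrite ge_min lexx.
have re : 16 * M ^+ 2 * r <= e.
  have : (1 + 16 * M ^+ 2) * r <= e.
    by rewrite -ler_pdivlMl// mulrC ge_min lexx orbT.
  by rewrite mulrDl mul1r; apply: le_trans; rewrite lerDr ltW.
have rlt : r < 1 - r by lra.
have := good_interval r0 rlt (ltac:(lra) : 1 - r < 1).
move=> /cvgrPdist_lt /(_ _ e0); apply: filterS => n; rewrite !sub0r !normrN.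
rewrite ger0_norm ?spread_ge0// ger0_norm; last first.
  by apply: bm_int_ge0 => u; exact: sqr_ge0.
move=> Sn; set J := `[r, 1 - r]%classic in Sn.
have mJ : measurable J by exact: measurable_itv.
have hM x : `|h n x| <= M by exact: transition_bound.
have H1 := spread_setT nu (bh n) mJ hM.
have Hm : \int[nu]_u h n u = 0 by rewrite (int_transition rho_pres th_pres bphi).
rewrite (spread_variance (bh n) Hm) in H1.
have HC : \int[nu]_x (\1_(~` J) x) = 2 * r.
  have EJ : \int[nu]_x (\1_J x) = 1 - 2 * r by rewrite int_unif_itvcc; [ring|lra|lra|lra].
  have bJ := bm_indic R mJ.
  transitivity (\int[nu]_x (1 - \1_J x)).
    apply: eq_Rintegral => x _; rewrite !indicE in_setC.
    by case: (x \in J) => /=; ring.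
  by rewrite (bm_intB _ (bm_cst R 1) bJ) int_cst EJ; ring.
rewrite HC in H1.
by rewrite -(ltr_pM2l (ltr0Sn R 1)); apply: (le_lt_trans H1); lra.
Qed.

(** $(\int\phi h_k)^2\le\int\phi^2h_k^2\le M^2\int h_k^2$, by Jensen's inequality and the bound on
    [phi]. *)
Lemma cvg_correlation : (fun k => \int[nu]_u (phi u * h k u)) @ \oo --> 0.
Proof.
have [M fM] := proj2 bphi.
have C2 : (fun k => (\int[nu]_u (phi u * h k u)) ^+ 2) @ \oo --> 0.
  apply: (cvg0_bound (K := M ^+ 2) _ cvg_transition_sqr) => k.
  rewrite sqr_ge0 /=.
  have bp := bmM bphi (bh k).
  apply: (le_trans (bm_int_sqr_le nu bp)).
  rewrite -(bm_intZ _ _ (bm_sqr (bh k))); apply: bm_int_le; first exact: bm_sqr.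
    by apply: bmM; [exact: bm_cst|exact/bm_sqr].
  move=> x; rewrite exprMn ler_wpM2r ?sqr_ge0//.
  rewrite -(real_normK (num_real (phi x))) lerXn2r// nnegrE//.
  exact: le_trans (fM x).
apply/cvgrPdist_lt => e e0; have e20 : 0 < e ^+ 2 by exact: exprn_gt0.
move/cvgrPdist_lt : C2 => /(_ _ e20); apply: filterS => k.
rewrite !sub0r !normrN normrX => H.
by rewrite -(@ltr_pXn2r _ 2)// nnegrE// ltW.
Qed.

Lemma chain_mean_ergodic :
  (fun n => \int[mprod nu ka]_p
     (n.+1%:R^-1 * \sum_(i < n.+1) phi (iter i (skew (metro al) th) p).1) ^+ 2)
  @ \oo --> 0.
Proof. exact: (mean_ergodic rho_pres th_pres bphi cvg_correlation). Qed.

End mixing.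

(** * Atomless spaces carry two independent uniform variables *)

(** Rays are stable under intersection and generate the Borel sets. *)
Lemma measure_unique_rays (R : realType) (m1 m2 : {measure set R -> \bar R}) :
  (forall x, m1 `]-oo, x]%classic = m2 `]-oo, x]%classic) ->
  (forall x, (m1 `]-oo, x]%classic < +oo)%E) ->
  forall A, measurable A -> m1 A = m2 A.
Proof.
move=> m12 m1oo; pose G := [set A : set R | exists x, A = `]-oo, x]%classic].
apply: (@measure_unique _ _ _ G (fun n => `]-oo, n%:R]%classic)).
- rewrite eqEsubset; split => A.
    apply: smallest_sub; first exact: smallest_sigma_algebra.
    move=> _ [x _ <-]; case: (ltP x.1 x.2) => x12; last first.
      by rewrite set_itv_ge ?bnd_simp -?leNgt//;
        exact: (@measurable0 _ (g_sigma_algebraType G)).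
    have -> : `]x.1, x.2]%classic = `]-oo, x.2]%classic `\` `]-oo, x.1]%classic.
      apply/seteqP; split => z /=; rewrite !in_itv /=.
        by move=> /andP[xz ->]; split => //; apply/negP; rewrite -ltNge.
      by move=> [-> /negP]; rewrite -ltNge => ->.
    by apply: (@measurableD _ (g_sigma_algebraType G)); apply: sub_sigma_algebra; eexists.
  apply: smallest_sub; first exact: smallest_sigma_algebra.
  by move=> _ [x ->]; exact: measurable_itv.
- move=> _ _ [x ->] [y ->]; exists (Num.min x y).
  apply/seteqP; split => z /=; rewrite !in_itv /= le_min; first by move=> [-> ->].
  by move=> /andP[].
- by move=> n; eexists.
- rewrite -subTset => x _; exists (Num.truncn `|x|).+1 => //=; rewrite in_itv /=.
  by rewrite (le_trans (ler_norm x))// ltW// truncnS_gt.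
- by move=> _ [x ->].
- by move=> n; exact: m1oo.
Qed.

(** * Sierpiński's theorem: an atomless probability takes all intermediate values *)

Section sierpinski.
Context d (T : measurableType d) (R : realType) (P : probability T R).
Hypothesis hP : atomless P.

Let pr (A : set T) : R := fine (P A).

Let prE A : measurable A -> P A = (pr A)%:E.
Proof. by move=> mA; rewrite /pr fineK// fin_num_measure. Qed.

Let pr_ge0 A : 0 <= pr A.
Proof. exact/fine_ge0/measure_ge0. Qed.

Let prD A B : measurable A -> measurable B -> B `<=` A ->
  pr (A `\` B) = pr A - pr B.
Proof.
move=> mA mB BA; apply: EFin_inj; rewrite -prE; last exact: measurableD.
rewrite EFinB -!prE// measureD// ?setIidr//.
by rewrite ltey_eq fin_num_measure.
Qed.

Let pr_le A B : measurable A -> measurable B -> A `<=` B -> pr A <= pr B.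
Proof.
by move=> mA mB AB; rewrite -lee_fin -!prE// le_measure// inE.
Qed.

(** Of a subset of intermediate measure and its complement in the set, one has at most half the
    measure; halving is then iterated. *)
Lemma atomless_small A e : measurable A -> 0 < pr A -> 0 < e ->
  exists B, [/\ measurable B, B `<=` A, 0 < pr B & pr B <= e].
Proof.
move=> mA A0 e0.
have step X : measurable X -> 0 < pr X ->
    exists B, [/\ measurable B, B `<=` X, 0 < pr B & pr B <= 2^-1 * pr X].
  move=> mX X0; have := hP mX; rewrite prE// lte_fin => /(_ X0) [B [mB BX]].
  rewrite prE// !lte_fin => B0 BltX.
  have [h|h] := leP (pr B) (2^-1 * pr X); first by exists B.
  exists (X `\` B); split => //; first exact: measurableD.
  - by rewrite prD// subr_gt0.
  - by rewrite prD//; lra.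
have iter_step n : exists B, [/\ measurable B, B `<=` A, 0 < pr B &
    pr B <= 2^-1 ^+ n * pr A].
  elim: n => [|n [B [mB BA B0 Bn]]]; first by exists A; split; rewrite ?expr0 ?mul1r.
  have [C [mC CB C0 Cn]] := step B mB B0; exists C; split => //.
    exact: subset_trans CB BA.
  by rewrite exprS -mulrA (le_trans Cn)// ler_wpM2l// invr_ge0.
have : (fun n => 2^-1 ^+ n * pr A) @ \oo --> 0 * pr A.
  apply: cvgMl; apply: cvg_expr; rewrite ger0_norm ?invr_ge0 ?ler0n//.
  by rewrite invf_lt1 ?ltr1n ?ltr0n.
rewrite mul0r => /cvgrPdist_lt /(_ _ e0) [N _ /(_ _ (leqnn N))] /=.
rewrite sub0r normrN ger0_norm ?mulr_ge0 ?exprn_ge0 ?invr_ge0 ?ler0n// => Ne.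
have [B [mB BA B0 Bn]] := iter_step N; exists B; split => //.
exact: le_trans Bn (ltW Ne).
Qed.

(* Greedy exhaustion: each step adds at least half of what can still be added. *)
Lemma atomless_split A c : measurable A -> 0 <= c <= pr A ->
  exists B, [/\ measurable B, B `<=` A & pr B = c].
Proof.
move=> mA /andP[c0 cA].
pose ok X := [/\ measurable X, X `<=` A & pr X <= c].
pose cand X E := [/\ measurable E, E `<=` A `\` X & pr X + pr E <= c].
have prU X E : measurable X -> measurable E -> E `<=` A `\` X ->
    pr (X `|` E) = pr X + pr E.
  move=> mX mE EX; apply: EFin_inj; rewrite EFinD -!prE//; last exact: measurableU.
  by rewrite measureU// -subset0 => t [Xt /EX[]].
have step X : exists Y, ok X -> [/\ ok Y, X `<=` Y &
    forall E, cand X E -> pr E <= 2 * (pr Y - pr X)].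
  have [[mX XA Xc]|nX] := pselect (ok X); last by exists X.
  pose S := [set pr E | E in cand X].
  have hS : has_sup S.
    split.
      exists (pr set0); exists set0 => //.
      by split; [exact: measurable0|exact: sub0set|rewrite /pr measure0 addr0].
    by exists c => _ [E [mE EX Ec] <-]; have := pr_ge0 X; lra.
  have [s0|s0] := leP (sup S) 0.
    exists X => _; split => // E cE; rewrite subrr mulr0 (le_trans _ s0)//.
    by apply: ub_le_sup; [exact: (proj2 hS)|exists E].
  have s2 : 0 < sup S / 2 by rewrite divr_gt0.
  have [_ [E [mE EX Ec] <-] hE] := sup_adherent s2 hS.
  exists (X `|` E) => _; split.
  - split; first exact: measurableU.
      by move=> t [/XA//|/EX[]].
    by rewrite prU.
  - by move=> t; left.
  - move=> E' cE'; rewrite prU// addrC addKr.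
    have : pr E' <= sup S by apply: ub_le_sup; [exact: (proj2 hS)|exists E'].
    by move: hE; lra.
have [st Hst] := choice step.
pose B n := iter n st set0.
have okB n : ok (B n).
  elim: n => [|n IH]; first by
    split; [exact: measurable0|exact: sub0set|rewrite /B /= /pr measure0].
  by have [] := Hst _ IH.
have mB n : measurable (B n) by have [] := okB n.
have mU : measurable (\bigcup_n B n) by exact: bigcupT_measurable.
have ndB : nondecreasing_seq B.
  apply/nondecreasing_seqP => n; apply/subsetPset.
  by have [_] := Hst _ (okB n).
have UA : \bigcup_n B n `<=` A.
  by move=> t [n _ Bt]; have [_ + _] := okB n; apply.
have cB : (fun n => pr (B n)) @ \oo --> pr (\bigcup_n B n).
  apply: (@fine_cvg _ _ _ _ (P \o B)); rewrite -prE//.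
  exact: nondecreasing_cvg_mu.
exists (\bigcup_n B n); split => //; apply/eqP; rewrite eq_le; apply/andP; split.
  have := cvg_lim (@Rhausdorff R) cB => <-.
  by apply: limr_le; [apply/cvg_ex; eexists; exact: cB|apply: nearW => n; have [] := okB n].
(* If the union fell short of [c], a small set [E] of positive measure in the remainder would be a
   candidate at every step. Its measure would then be at most twice each increment, and the
   increments tend to 0. *)
rewrite leNgt; apply/negP => Uc.
have AU : 0 < pr (A `\` \bigcup_n B n) by rewrite prD//; lra.
have e0 : 0 < c - pr (\bigcup_n B n) by lra.
have mAU : measurable (A `\` \bigcup_n B n) by exact: measurableD.
have [E [mE EA E0 Ee]] := atomless_small mAU AU e0.
have candE n : cand (B n) E.
  split => //.
    by move=> t /EA [At nUt]; split => // Bt; apply: nUt; exists n.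
  have : pr (B n) <= pr (\bigcup_n B n).
    by apply: pr_le => // t Bt; exists n.
  by lra.
have En n : pr E <= 2 * (pr (B n.+1) - pr (B n)).
  by have [_ _] := Hst _ (okB n); apply.
have c2 : (fun n => 2 * (pr (B n.+1) - pr (B n))) @ \oo --> 0.
  rewrite -(mulr0 2) -(subrr (pr (\bigcup_n B n))); apply: cvgMr; apply: cvgB => //.
  by rewrite (cvg_shiftS (fun n => pr (B n))).
have : pr E <= 0.
  rewrite -(cvg_lim (@Rhausdorff R) c2); apply: limr_ge.
    by apply/cvg_ex; eexists; exact: c2.
  exact: nearW.
by rewrite leNgt E0.
Qed.

End sierpinski.

Lemma prod_lip (R : realFieldType) (x y x' y' e : R) :
  0 <= x <= 1 -> 0 <= y' <= 1 -> 0 <= e -> x - x' <= e -> y - y' <= e ->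
  x * y - x' * y' <= 2 * e.
Proof.
move=> /andP[x0 x1] /andP[y0 y1] e0 xx yy.
have -> : x * y - x' * y' = x * (y - y') + (x - x') * y' by ring.
have H1 : x * (y - y') <= x * e by rewrite ler_wpM2l.
have H2 : (x - x') * y' <= e * y' by rewrite ler_wpM2r.
have H3 : x * e <= e by rewrite ler_piMl.
have H4 : e * y' <= e by rewrite ler_piMr.
lra.
Qed.

(** * Independent uniform variables from repeated halving *)

Section two_uniforms.
Context d (T : measurableType d) (R : realType) (P : probability T R).
Hypothesis hP : atomless P.

Let pr (A : set T) : R := fine (P A).

Let prE A : measurable A -> P A = (pr A)%:E.
Proof. by move=> mA; rewrite /pr fineK// fin_num_measure. Qed.

Let pr_ge0 A : 0 <= pr A.
Proof. exact/fine_ge0/measure_ge0. Qed.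

Let half_ex : exists half : set T -> set T, forall A, measurable A ->
  [/\ measurable (half A), half A `<=` A & pr (half A) = 2^-1 * pr A].
Proof.
suff ex A : exists B, measurable A ->
    [/\ measurable B, B `<=` A & pr B = 2^-1 * pr A].
  by have [f Hf] := choice ex; exists f.
have [mA|nmA] := pselect (measurable A); last by exists A.
have cA : 0 <= 2^-1 * pr A <= pr A.
  by have := pr_ge0 A; move=> h; apply/andP; split; lra.
by have [B [mB BA EB]] := atomless_split hP mA cA; exists B.
Qed.

Let half := sval (cid half_ex).
Let halfP : forall A, measurable A ->
  [/\ measurable (half A), half A `<=` A & pr (half A) = 2^-1 * pr A] :=
  svalP (cid half_ex).

Let sel (b : bool) (X : set T) := if b then half X else X `\` half X.

Let sel_meas b X : measurable X -> measurable (sel b X).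
Proof.
by move=> mX; have [mh _ _] := halfP mX; case: b => //; exact: measurableD.
Qed.

Let sel_sub b X : measurable X -> sel b X `<=` X.
Proof. by move=> mX; have [_ hX _] := halfP mX; case: b => //= t []. Qed.

Let sel_split X E : measurable X -> measurable E ->
  pr (X `&` E) = pr (sel true X `&` E) + pr (sel false X `&` E).
Proof.
move=> mX mE; have m1 := sel_meas true mX; have m2 := sel_meas false mX.
have [_ hX _] := halfP mX.
apply: EFin_inj; rewrite EFinD -!prE; try exact: measurableI.
rewrite -measureU; try exact: measurableI.
  congr (P _); apply/seteqP; split => t /=.
    by move=> [Xt Et]; have [h|h] := pselect (half X t); [left|right].
  by move=> [[/hX Xt Et]|[[Xt _] Et]].
by rewrite -subset0 => t /= [[h _] [[_ nh] _]].
Qed.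

Let sel_pr b X : measurable X -> pr (sel b X) = 2^-1 * pr X.
Proof.
move=> mX; have [_ _ hX] := halfP mX; case: b => //.
have := sel_split mX measurableT; rewrite !setIT /= hX => ?; lra.
Qed.

(** Each level halves a cell twice, once for each coordinate of the future pair, so a cell of depth
    [n] has measure $4^{-n}$. The most recent pair of bits is at the head of the list. *)
Let cell := fix cell (s : seq (bool * bool)) : set T :=
  if s is x :: s' then sel x.2 (sel x.1 (cell s')) else setT.

Let cell_meas s : measurable (cell s).
Proof. by elim: s => [|x s IH]; [exact: measurableT|do 2 apply: sel_meas]. Qed.

Let h : R := 2^-1.

Let hn_ge0 n : 0 <= h ^+ n.
Proof. by rewrite exprn_ge0// invr_ge0. Qed.

Let hS n : h ^+ n = h ^+ n.+1 + h ^+ n.+1.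
Proof.
rewrite exprS -mulrDl (_ : h + h = 1) ?mul1r//.
by rewrite /h; lra.
Qed.

Let cell_pr s : pr (cell s) = h ^+ size s * h ^+ size s.
Proof.
elim: s => [|x s IH] /=; first by rewrite /pr probability_setT !expr0 mul1r.
rewrite sel_pr; last exact/sel_meas/cell_meas.
by rewrite sel_pr// IH !exprS -/h; ring.
Qed.

(** The address of depth [n] of the point [t]: [cell_code] and [code_cell] show that it is the only
    one whose cell contains [t]. *)
Let code := fix code n t : seq (bool * bool) :=
  if n is n'.+1 then let s := code n' t in
    let b1 := `[< half (cell s) t >] in
    (b1, `[< half (sel b1 (cell s)) t >]) :: s
  else [::].

Let size_code n t : size (code n t) = n.
Proof. by elim: n => //= n ->. Qed.

Let sel_asbool X t : X t -> sel `[< half X t >] X t.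
Proof. by move=> Xt; case: asboolP. Qed.

Let asbool_sel b X t : measurable X -> sel b X t -> `[< half X t >] = b.
Proof. by case: b => mX /=; [move/asboolT|move=> [_ /asboolF]]. Qed.

Let cell_code n t : cell (code n t) t.
Proof. by elim: n => //= n IH; do 2 apply: sel_asbool. Qed.

Let code_cell s t : cell s t -> code (size s) t = s.
Proof.
elim: s => //= -[b1 b2] s IH /= Hs.
have ms1 := sel_meas b1 (cell_meas s).
have H1 := sel_sub ms1 Hs; have H0 := sel_sub (cell_meas s) H1.
rewrite IH//; have -> := asbool_sel (cell_meas s) H1.
by rewrite (asbool_sel ms1 Hs).
Qed.

(** A finite binary expansion with digits selected by [f], which will be [fst] or [snd]; the head of
    the list is the least significant digit. *)
Let value (f : bool * bool -> bool) := fix value (s : seq (bool * bool)) : R :=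
  if s is x :: s' then value s' + (f x)%:R * h ^+ (size s').+1 else 0.

Let value_incr f n t : value f (code n t) <= value f (code n.+1 t).
Proof. by rewrite /= lerDl mulr_ge0. Qed.

Let value_code_le f n k t :
  value f (code (k + n) t) <= value f (code n t) + h ^+ n - h ^+ (k + n).
Proof.
elim: k => [|k IH]; first by rewrite add0n addrK.
rewrite addSn /= size_code.
have : (f (`[< half (cell (code (k + n) t)) t >],
     `[< half (sel `[< half (cell (code (k + n) t)) t >]
                  (cell (code (k + n) t))) t >]))%:R * h ^+ (k + n).+1
     <= h ^+ (k + n).+1.
  by rewrite ler_piMl// lern1; case: (f _).
by move: IH; rewrite [h ^+ (k + n)]hS; lra.
Qed.

Let value_code_ge f n k t : value f (code n t) <= value f (code (k + n) t).
Proof.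
by elim: k => // k IH; rewrite addSn (le_trans IH)//; exact: value_incr.
Qed.

Let U f t : R := limn (fun n => value f (code n t)).

Let cvgU f t : (fun n => value f (code n t)) @ \oo --> U f t.
Proof.
apply: nondecreasing_is_cvgn; first by apply/nondecreasing_seqP => n; exact: value_incr.
exists 1 => _ [n _ <-]; have := value_code_le f 0 n t.
by rewrite addn0 /= expr0; have := hn_ge0 n; lra.
Qed.

Let U_bound f n t : value f (code n t) <= U f t <= value f (code n t) + h ^+ n.
Proof.
have c := @cvgU f t; apply/andP; split.
  apply: limr_ge; first by apply/cvg_ex; eexists; exact: c.
  near=> m; have nm : (n <= m)%N by near: m; exact: nbhs_infty_ge.
  by rewrite -(subnK nm) value_code_ge.
apply: limr_le; first by apply/cvg_ex; eexists; exact: c.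
near=> m; have nm : (n <= m)%N by near: m; exact: nbhs_infty_ge.
rewrite -(subnK nm) (le_trans (value_code_le _ _ _ _))// lerBlDr lerDl.
exact: hn_ge0.
Unshelve. all: by end_near. Qed.

Let U01 f t : 0 <= U f t <= 1.
Proof. by have := U_bound f 0 t; rewrite /= add0r expr0. Qed.

Let measurable_code_value f n : measurable_fun setT (fun t => value f (code n t)).
Proof.
move=> _ Y mY; rewrite setTI.
(* The value depends on the address alone, and there are countably many addresses. *)
have -> : (fun t => value f (code n t)) @^-1` Y =
    \bigcup_s (if (size s == n) && `[< Y (value f s) >] then cell s else set0).
  apply/seteqP; split => t /=.
    move=> Yt; exists (code n t) => //.
    by rewrite size_code eqxx /= asboolT//; exact: cell_code.
  move=> [s _]; case: ifP => // /andP[/eqP <- /asboolP Ys] /code_cell ->.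
  exact: Ys.
apply: countable_bigcupT_measurable; first exact: countableP.
by move=> s; case: ifP.
Qed.

Let measurable_U f : measurable_fun setT (U f).
Proof.
apply: (measurable_fun_cvg (measurable_code_value f)) => t _; exact: cvgU.
Qed.

(** The length of the part of the dyadic interval $[v,v+2^{-k}]$ that lies to the left of [a]. *)
Let L (v : R) k a := Num.max 0 (Num.min (a - v) (h ^+ k)).

Let L_split v k a : L v k a = L v k.+1 a + L (v + h ^+ k.+1) k.+1 a.
Proof.
rewrite /L hS; have := hn_ge0 k.+1; move: (h ^+ k.+1) => q q0.
rewrite /Num.max /Num.min.
case: (ltP (a - v) (q + q)) => ?; case: (ltP (a - v) q) => ?;
case: (ltP (a - (v + q)) q) => ?; repeat case: ltP => ?; lra.
Qed.

Let L_ge0 v k a : 0 <= L v k a.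
Proof. by rewrite /L le_max lexx. Qed.

Let L_full v k a : v <= a - h ^+ k -> L v k a = h ^+ k.
Proof.
by move=> va; rewrite /L min_r ?max_r//; lra.
Qed.

Let L_empty v k a : a <= v -> L v k a = 0.
Proof.
move=> av; rewrite /L max_l// ge_min; apply/orP; left; lra.
Qed.

Let L_le v k a : L v k a <= h ^+ k.
Proof. by rewrite /L ge_max hn_ge0 ge_min lexx orbT. Qed.

Let ev a b := [set t | U fst t <= a /\ U snd t <= b].

Let ev_meas a b : measurable (ev a b).
Proof.
have -> : ev a b = U fst @^-1` `]-oo, a]%classic `&` U snd @^-1` `]-oo, b]%classic.
  by apply/seteqP; split => t /=; rewrite !in_itv.
by apply: measurableI; rewrite -[X in measurable X]setTI;
  apply: measurable_U => //; exact: measurable_itv.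
Qed.

Let cell_ev_split s a b : pr (cell s `&` ev a b) =
  pr (cell ((true, true) :: s) `&` ev a b) + pr (cell ((true, false) :: s) `&` ev a b)
  + (pr (cell ((false, true) :: s) `&` ev a b) + pr (cell ((false, false) :: s) `&` ev a b)).
Proof.
rewrite (sel_split (cell_meas s) (ev_meas a b)).
by rewrite (sel_split (sel_meas true (cell_meas s)) (ev_meas a b))
           (sel_split (sel_meas false (cell_meas s)) (ev_meas a b)).
Qed.

Let pr_le A B : measurable A -> measurable B -> A `<=` B -> pr A <= pr B.
Proof.
by move=> mA mB AB; rewrite -lee_fin -!prE// le_measure// inE.
Qed.

(** Induction on the number [m] of further subdivisions: [L] is additive under halving, so the
    bounds of the four subcells add up to that of the cell. At the finest level, enlarging [a] and
    [b] by the mesh makes the bound the full measure of any cell that can meet the event. *)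
Let cell_upper m s a b : pr (cell s `&` ev a b) <=
  L (value fst s) (size s) (a + h ^+ (size s + m)) *
  L (value snd s) (size s) (b + h ^+ (size s + m)).
Proof.
elim: m s => [|m IH] s; last first.
  rewrite cell_ev_split (L_split (value fst s)) (L_split (value snd s)).
  have H b1 b2 := IH ((b1, b2) :: s).
  have := H true true; have := H true false; have := H false true; have := H false false.
  rewrite /= !mul0r !addr0 !mul1r addSnnS.
  rewrite mulrDl !mulrDr; lra.
rewrite addn0; set k := size s.
have E0 : cell s `&` ev a b = set0 -> pr (cell s `&` ev a b) = 0.
  by move=> ->; rewrite /pr measure0.
have bd f t : cell s t -> value f s <= U f t.
  by move=> /code_cell; have /andP[] := U_bound f (size s) t => /[swap] _ /[swap] ->.
have [va|va] := ltP a (value fst s).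
  rewrite E0 ?mulr_ge0// -subset0 => t [/(bd fst) h1 [h2 _]].
  by have := le_lt_trans (le_trans h1 h2) va; rewrite ltxx.
have [vb|vb] := ltP b (value snd s).
  rewrite E0 ?mulr_ge0// -subset0 => t [/(bd snd) h1 [_ h2]].
  by have := le_lt_trans (le_trans h1 h2) vb; rewrite ltxx.
rewrite !L_full; [|lra|lra].
rewrite -cell_pr; apply: pr_le; last exact: subIsetl.
  exact: measurableI.
exact: cell_meas.
Qed.

(** The same induction with [a] and [b] reduced by the mesh: at the finest level the bound is
    nonzero only for cells contained in the event. *)
Let cell_lower m s a b :
  L (value fst s) (size s) (a - h ^+ (size s + m)) *
  L (value snd s) (size s) (b - h ^+ (size s + m)) <= pr (cell s `&` ev a b).
Proof.
elim: m s => [|m IH] s; last first.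
  rewrite cell_ev_split (L_split (value fst s)) (L_split (value snd s)).
  have H b1 b2 := IH ((b1, b2) :: s).
  have := H true true; have := H true false; have := H false true; have := H false false.
  rewrite /= !mul0r !addr0 !mul1r addSnnS.
  rewrite mulrDl !mulrDr; lra.
rewrite addn0; set k := size s.
have bd f t : cell s t -> U f t <= value f s + h ^+ k.
  by move=> /code_cell; have /andP[] := U_bound f (size s) t => _ /[swap] ->.
have [va|va] := ltP a (value fst s + h ^+ k).
  by rewrite L_empty ?mul0r//; lra.
have [vb|vb] := ltP b (value snd s + h ^+ k).
  by rewrite [X in _ * X]L_empty ?mulr0//; lra.
have -> : cell s `&` ev a b = cell s.
  apply/setIidPl => t ct; split.
    by rewrite (le_trans (bd fst t ct)).
  by rewrite (le_trans (bd snd t ct)).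
by rewrite cell_pr ler_pM.
Qed.

(** At the root, where the cell is the whole space, both bounds tend to the product as the mesh
    shrinks. *)
Let ev_pr a b : pr (ev a b) = clamp a * clamp b.
Proof.
have L0 x : L 0 0 x = clamp x by rewrite /L subr0 expr0.
have c0 := cell_upper; have Hh : (fun m => 3 * h ^+ m) @ \oo --> 0.
  rewrite -(mulr0 3); apply: cvgMr; apply: cvg_expr.
  by rewrite /h ger0_norm ?invr_ge0 ?ler0n// invf_lt1 ?ltr1n ?ltr0n.
have bd m : `|pr (ev a b) - clamp a * clamp b| <= 3 * h ^+ m.
  have := cell_upper m [::] a b; have := cell_lower m [::] a b.
  rewrite /= !setTI !add0n !L0 => h1 h2.
  have hm := hn_ge0 m.
  have hm1 : h ^+ m <= 1 by rewrite exprn_ile1 /h ?invr_ge0 ?invf_le1 ?ler1n.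
  have l1 := clamp_lip (_ : a <= a + h ^+ m).
  have l2 := clamp_lip (_ : b <= b + h ^+ m).
  have l3 := clamp_lip (_ : a - h ^+ m <= a).
  have l4 := clamp_lip (_ : b - h ^+ m <= b).
  have {}l1 : clamp (a + h ^+ m) - clamp a <= h ^+ m by have := l1 ltac:(lra); lra.
  have {}l2 : clamp (b + h ^+ m) - clamp b <= h ^+ m by have := l2 ltac:(lra); lra.
  have {}l3 : clamp a - clamp (a - h ^+ m) <= h ^+ m by have := l3 ltac:(lra); lra.
  have {}l4 : clamp b - clamp (b - h ^+ m) <= h ^+ m by have := l4 ltac:(lra); lra.
  have c01 (x : R) : 0 <= clamp x <= 1 by rewrite clamp_ge0 clamp_le1.
  have := prod_lip (c01 a) (c01 (b - h ^+ m)) hm l3 l4.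
  have := prod_lip (c01 (a + h ^+ m)) (c01 b) hm l1 l2.
  by rewrite ler_norml => *; apply/andP; split; lra.
apply/eqP; rewrite -subr_eq0 -normr_eq0 eq_le normr_ge0 andbT.
rewrite -(cvg_lim (@Rhausdorff R) Hh); apply: limr_ge; last exact: nearW.
by apply/cvg_ex; eexists; exact: Hh.
Qed.

(** Uniqueness on rays in one coordinate while the other is held in [B]. Used once for each
    coordinate, it turns [ev_pr] into the product formula on all rectangles. *)
Let ray_extend (V1 V2 : T -> R) (g : R) (B : set R) :
  measurable_fun setT V1 -> measurable_fun setT V2 -> 0 <= g -> measurable B ->
  (forall a, P (V1 @^-1` `]-oo, a]%classic `&` V2 @^-1` B) = (g * clamp a)%:E) ->
  forall A, measurable A ->
    P (V1 @^-1` A `&` V2 @^-1` B) = (g%:E * unif R A)%E.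
Proof.
move=> mV1 mV2 g0 mB H A mA.
have mVB : measurable (V2 @^-1` B) by rewrite -[X in measurable X]setTI; exact: mV2.
pose m0 : {measure set R -> \bar R} := pushforward (mrestr P mVB) V1.
pose m1 := m0 mV1.
pose m2 : {measure set R -> \bar R} := mscale (NngNum g0) (unif R).
suff : m1 A = m2 A by [].
apply: measure_unique_rays => // x.
  by rewrite [LHS]H [RHS]/(g%:E * unif R _)%E unif_itvNyc EFinM.
by rewrite [X in (X < _)%E]H ltry.
Qed.

(** The bounds hold at every point, not only almost surely, so the chain built on [Z] is bounded
    everywhere. *)
Lemma two_uniforms : exists Z : T -> R * R,
  meas_pres P (mprod (unif R) (unif R)) Z /\
  forall t, 0 <= (Z t).1 <= 1 /\ 0 <= (Z t).2 <= 1.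
Proof.
exists (fun t => (U fst t, U snd t)); split; last by move=> t; split; exact: U01.
have mV : measurable_fun setT (fun t => (U fst t, U snd t)).
  by apply: measurable_fun_pair; exact: measurable_U.
split => // A mA.
have ray a B : measurable B ->
    P (U snd @^-1` B `&` U fst @^-1` `]-oo, a]%classic) = ((clamp a)%:E * unif R B)%E.
  apply: (ray_extend (@measurable_U snd) (@measurable_U fst) (clamp_ge0 a)
    (measurable_itv _)) => b.
  rewrite -ev_pr -prE//; congr (P _); apply/seteqP; split => t /=; rewrite !in_itv /=.
    by move=> [].
  by move=> [].
have rect B C : measurable B -> measurable C ->
    P (U fst @^-1` B `&` U snd @^-1` C) = (unif R B * unif R C)%E.
  move=> mB mC; have u0 : 0 <= fine (unif R C) by exact/fine_ge0/measure_ge0.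
  rewrite muleC -[unif R C]fineK ?fin_num_measure//.
  apply: (ray_extend (@measurable_U fst) (@measurable_U snd) u0 mC) => // a.
  by rewrite setIC ray// mulrC EFinM fineK// fin_num_measure.
pose m0 : {measure set (R * R) -> \bar R} :=
  pushforward P (fun t => (U fst t, U snd t)).
apply/esym; apply: (@product_measure_unique _ _ _ _ _ (unif R) (unif R)
  (m0 mV)) => //.
Qed.

End two_uniforms.

(** * Copulas *)

Lemma lip1_continuous (R : realType) (f : R -> R) :
  (forall x y, x <= y -> `|f y - f x| <= y - x) -> continuous f.
Proof.
move=> Hf x; apply/cvgrPdist_lt => e e0; near=> y.
have xy : `|x - y| < e by near: y; exact: cvgr_dist_lt.
case: (leP x y) => h; [rewrite distrC|].
  by rewrite (le_lt_trans (Hf _ _ h))// -(ger0_norm (_ : 0 <= y - x)) ?subr_ge0// distrC.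
by rewrite (le_lt_trans (Hf _ _ (ltW h)))// -(ger0_norm (_ : 0 <= x - y)) ?subr_ge0 ?ltW.
Unshelve. all: by end_near. Qed.

Lemma probabilityD d (T : measurableType d) (R : realType) (P : probability T R)
    (A B : set T) : measurable A -> measurable B -> B `<=` A ->
  P (A `\` B) = (P A - P B)%E.
Proof.
move=> mA mB BA; rewrite measureD// ?setIidr//.
by rewrite ltey_eq fin_num_measure.
Qed.

(** The mass of [A] to the left of [x] is 1-Lipschitz in [x], so some ray cuts off exactly half of
    it. *)
Lemma atomless_unif (R : realType) : atomless (unif R).
Proof.
move=> A mA A0; pose F x := fine (unif R (A `&` `]-oo, x]%classic)).
have mAx x : measurable (A `&` `]-oo, x]%classic).
  by apply: measurableI => //; exact: measurable_itv.
have FE x : unif R (A `&` `]-oo, x]%classic) = (F x)%:E.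
  by rewrite fineK// fin_num_measure.
have cF : continuous F.
  apply: lip1_continuous => x y xy.
  have D : unif R (A `&` `]x, y]%classic) = (F y - F x)%:E.
    rewrite EFinB -!FE -probabilityD//; last first.
      by apply: setIS; apply: subset_itvl; rewrite bnd_simp.
    congr (unif R _); apply/seteqP; split => z /=; rewrite !in_itv /=.
      by move=> [Az /andP[xz zy]]; split => // -[_]; rewrite leNgt xz.
    move=> [[Az zy] H]; split => //; rewrite zy andbT ltNge; apply/negP => zx.
    by apply: H.
  have mxy : measurable (`]x, y]%classic : set R) by exact: measurable_itv.
  rewrite ger0_norm; last by rewrite -lee_fin -D.
  rewrite -lee_fin -D (@le_trans _ _ (unif R `]x, y]%classic))//.
    by rewrite le_measure// inE//; exact: measurableI.
  by rewrite unif_itvoc// lee_fin clamp_lip.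
pose c := fine (unif R A).
have cE : unif R A = c%:E by rewrite fineK// fin_num_measure.
have c0 : 0 < c by rewrite -lte_fin -cE.
have F0 : F 0 = 0.
  apply: EFin_inj; rewrite -FE; apply/eqP; rewrite eq_le measure_ge0 andbT.
  rewrite (@le_trans _ _ (unif R `]-oo, 0]%classic))//.
    by rewrite le_measure// inE//; exact: measurable_itv.
  by rewrite unif_itvNyc clamp_id// lexx ler01.
have F1 : F 1 = c.
  apply: EFin_inj; rewrite -FE -cE.
  have m1 : measurable (`]-oo, 1]%classic : set R) by exact: measurable_itv.
  have N1 : unif R (A `\` `]-oo, 1]%classic) = 0%E.
    apply/eqP; rewrite eq_le measure_ge0 andbT.
    rewrite (@le_trans _ _ (unif R (~` `]-oo, 1]%classic)))//.
      by rewrite le_measure// inE//; [exact: measurableD|exact: measurableC].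
    rewrite [leLHS]probability_setC// [X in (_ - X)%E]unif_itvNyc clamp_id ?lexx ?ler01//.
    by rewrite subee.
  have m2 : measurable (A `\` `]-oo, 1]%classic) by exact: measurableD.
  rewrite -[in RHS](setUIDK A `]-oo, 1]%classic) measureU//.
    by rewrite [X in (_ + X)%E]N1 adde0.
  by rewrite -subset0 => z [] [_ ?] [].
have [x _ Fx] : exists2 x, x \in `[0, 1] & F x = c / 2.
  apply: IVT => //; first exact: continuous_subspaceT.
  by rewrite F0 F1 (min_l (ltW c0)) (max_r (ltW c0)); apply/andP; split; lra.
exists (A `&` `]-oo, x]%classic); split => //.
  by rewrite FE lte_fin Fx; lra.
by rewrite FE cE lte_fin Fx; lra.
Qed.

Section copula_theory.
Context (R : realType).
Implicit Types C : R -> R -> R.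

Section from_law.
Context d (E : measurableType d) (m : probability E R) (X Y : E -> R).
Hypothesis mpX : meas_pres m (unif R) X.
Hypothesis mpY : meas_pres m (unif R) Y.

(** For uniform [X] and [Y] the joint distribution function is itself the copula. *)
Definition law_copula (u v : R) : R := fine (m [set e | X e <= u /\ Y e <= v]).

Let mX : measurable_fun setT X := proj1 mpX.
Let mY : measurable_fun setT Y := proj1 mpY.

Lemma measurable_quadrant u v : measurable [set e | X e <= u /\ Y e <= v].
Proof.
have -> : [set e | X e <= u /\ Y e <= v] =
    X @^-1` `]-oo, u]%classic `&` Y @^-1` `]-oo, v]%classic.
  by apply/seteqP; split => t /=; rewrite !in_itv.
by apply: measurableI; rewrite -[X in measurable X]setTI;
  [apply: mX|apply: mY] => //; exact: measurable_itv.
Qed.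

Lemma law_copulaE u v : m [set e | X e <= u /\ Y e <= v] = (law_copula u v)%:E.
Proof. by rewrite fineK// fin_num_measure//; exact: measurable_quadrant. Qed.

Lemma law_copulaP : copula2 law_copula.
Proof.
have mV : measurable_fun setT (fun e => (X e, Y e)) by exact: measurable_fun_pair.
pose V : {mfun E >-> (R * R)%type} := HB.pack (fun e => (X e, Y e))
  (isMeasurableFun.Build _ _ _ _ _ mV).
exists (distribution m V); split.
- by move=> A mA; rewrite -unifE -(proj2 mpX A mA).
- by move=> A mA; rewrite -unifE -(proj2 mpY A mA).
- move=> u v; rewrite -law_copulaE; congr (m _).
Qed.

End from_law.

(** The increment is the mass of a half-strip, contained in a strip whose mass is given by the
    uniform marginal. *)
Lemma copula_incr2 C u v v' : copula2 C -> v <= v' ->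
  0 <= C u v' - C u v <= clamp v' - clamp v.
Proof.
move=> [mu [_ mu2 muC]] vv.
have mr (w : R) : measurable (`]-oo, w]%classic : set R) by exact: measurable_itv.
have D : mu (`]-oo, u]%classic `*` `]v, v']%classic) = (C u v' - C u v)%:E.
  rewrite EFinB -!muC -probabilityD; [|exact: measurableX|exact: measurableX|]; last first.
    by apply: setSX => //; apply: subset_itvl; rewrite bnd_simp.
  congr (mu _); apply/seteqP; split => -[x y] /=; rewrite !in_itv /=.
    by move=> [xu /andP[vy yv]]; split => // -[_]; rewrite leNgt vy.
  move=> [[xu yv] H]; split => //; rewrite yv andbT ltNge; apply/negP => h.
  exact: H.
have mvv : measurable (`]v, v']%classic : set R) by exact: measurable_itv.
apply/andP; split; first by rewrite -lee_fin -D.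
rewrite -lee_fin -D -unif_itvoc// unifE -mu2// le_measure// ?inE.
- exact: measurableX.
- by rewrite -[X in measurable X]setTI; exact: measurable_snd.
- by move=> [x y] [].
Qed.

Lemma copula_incr1 C u u' v : copula2 C -> u <= u' ->
  0 <= C u' v - C u v <= clamp u' - clamp u.
Proof.
move=> [mu [mu1 _ muC]] uu.
have mr (w : R) : measurable (`]-oo, w]%classic : set R) by exact: measurable_itv.
have D : mu (`]u, u']%classic `*` `]-oo, v]%classic) = (C u' v - C u v)%:E.
  rewrite EFinB -!muC -probabilityD; [|exact: measurableX|exact: measurableX|]; last first.
    by apply: setSX => //; apply: subset_itvl; rewrite bnd_simp.
  congr (mu _); apply/seteqP; split => -[x y] /=; rewrite !in_itv /=.
    by move=> [/andP[ux xu] yv]; split => // -[]; rewrite leNgt ux.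
  move=> [[xu yv] H]; split => //; rewrite xu andbT ltNge; apply/negP => h.
  exact: H.
have mvv : measurable (`]u, u']%classic : set R) by exact: measurable_itv.
apply/andP; split; first by rewrite -lee_fin -D.
rewrite -lee_fin -D -unif_itvoc// unifE -mu1// le_measure// ?inE.
- exact: measurableX.
- by rewrite -[X in measurable X]setTI; exact: measurable_fst.
- by move=> [x y] [].
Qed.

Lemma copula_le1 C u v : copula2 C -> C u v <= clamp u.
Proof.
move=> [mu [mu1 _ muC]]; rewrite -lee_fin -muC -unif_itvNyc unifE -mu1//.
rewrite le_measure// ?inE.
- by apply: measurableX; exact: measurable_itv.
- by rewrite -[X in measurable X]setTI; apply: measurable_fst => //; exact: measurable_itv.
- by move=> [x y] [].
Qed.

Lemma copula_le2 C u v : copula2 C -> C u v <= clamp v.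
Proof.
move=> [mu [_ mu2 muC]]; rewrite -lee_fin -muC -unif_itvNyc unifE -mu2//.
rewrite le_measure// ?inE.
- by apply: measurableX; exact: measurable_itv.
- by rewrite -[X in measurable X]setTI; apply: measurable_snd => //; exact: measurable_itv.
- by move=> [x y] [].
Qed.

Lemma copula_ge0 C u v : copula2 C -> 0 <= C u v.
Proof. by move=> [mu [_ _ muC]]; rewrite -lee_fin -muC. Qed.

(** This is $\delta$, extended to the line: for a pair with law [C], the probability that the first
    coordinate is at most [u] and the second exceeds [u]. *)
Definition diag_gap C u := clamp u - C u u.

Lemma diag_gap_ge0 C u : copula2 C -> 0 <= diag_gap C u.
Proof. by move=> hC; rewrite subr_ge0 copula_le1. Qed.

(** From [x] to [y] the diagonal of [C] grows by at least 0 and at most twice the growth of [clamp],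
    so the gap changes by at most one growth of [clamp] in either direction. *)
Lemma diag_gap_lip C x y : copula2 C -> x <= y ->
  `|diag_gap C y - diag_gap C x| <= y - x.
Proof.
move=> hC xy; have := clamp_lip xy; rewrite /diag_gap ler_norml.
have /andP[] := copula_incr1 y hC xy; have /andP[] := copula_incr2 x hC xy.
by move=> *; apply/andP; split; lra.
Qed.

Lemma copula_clamp C u v : copula2 C -> C (clamp u) (clamp v) = C u v.
Proof.
move=> hC; have cc (x : R) : clamp (clamp x) = clamp x.
  by rewrite clamp_id// clamp_ge0 clamp_le1.
transitivity (C u (clamp v)).
  case: (leP u (clamp u)) => [h|/ltW h]; have := copula_incr1 (clamp v) hC h;
  rewrite cc subrr; lra.
case: (leP v (clamp v)) => [h|/ltW h]; have := copula_incr2 u hC h;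
rewrite cc subrr; lra.
Qed.

End copula_theory.

Lemma meas_pres_fst d1 d2 (T1 : measurableType d1) (T2 : measurableType d2)
    (R : realType) (m1 : probability T1 R) (m2 : probability T2 R) :
  meas_pres (mprod m1 m2) m1 fst.
Proof.
apply: meas_pres_int; first exact: measurable_fst.
move=> f bf; rewrite bm_fubini1; last exact: bm_comp measurable_fst bf.
by apply: eq_Rintegral => x _; rewrite /= int_cst.
Qed.

Lemma meas_pres_snd d1 d2 (T1 : measurableType d1) (T2 : measurableType d2)
    (R : realType) (m1 : probability T1 R) (m2 : probability T2 R) :
  meas_pres (mprod m1 m2) m2 snd.
Proof.
apply: meas_pres_int; first exact: measurable_snd.
move=> f bf; rewrite bm_fubini2; last exact: bm_comp measurable_snd bf.
by apply: eq_Rintegral => x _; rewrite /= int_cst.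
Qed.

(** * The copula of one Metropolis step *)

Section metropolis_copula.
Context (R : realType).
Let nu := unif R.
Variable al : R * R -> R.
Hypothesis mal : measurable_fun setT al.
Hypothesis sal : forall u v, al (u, v) = al (v, u).

Definition metro_copula : R -> R -> R :=
  law_copula (mprod nu (mprod nu nu)) fst (metro al).

Let m := mprod nu (mprod nu nu).
Let rho_pres : meas_pres m nu (metro al) := metro_pres nu nu mal sal.
Let fst_pres : meas_pres m nu fst := meas_pres_fst nu (mprod nu nu).

Lemma metro_copulaP : copula2 metro_copula.
Proof. exact: (law_copulaP fst_pres rho_pres). Qed.

Let noise_pres : meas_pres m nu (snd \o snd).
Proof. exact: meas_pres_comp (meas_pres_snd nu nu) (meas_pres_snd nu (mprod nu nu)). Qed.

Let noise_law c : 0 <= c <= 1 -> m [set e | e.2.2 < c] = c%:E.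
Proof.
move=> c01; rewrite -[c in RHS]clamp_id// -unif_itvNyo.
rewrite -(proj2 noise_pres); last exact: measurable_itv.
by congr (m _); apply/seteqP; split => e /=; rewrite in_itv.
Qed.

Let ray_law X a : meas_pres m nu X ->
  measurable [set e | X e <= a] /\ m [set e | X e <= a] = (clamp a)%:E.
Proof.
move=> [mX EX].
have E : [set e | X e <= a] = X @^-1` `]-oo, a]%classic.
  by apply/seteqP; split => e /=; rewrite in_itv.
rewrite E EX; last exact: measurable_itv.
split; last exact: unif_itvNyc.
by rewrite -[X in measurable X]setTI; apply: mX => //; exact: measurable_itv.
Qed.

(* Only accepted moves cross from one side to the other, and acceptance needs
   the noise to stay below [al]. *)
Lemma metro_copula_ge a b c : 0 <= c -> c <= clamp a -> c <= clamp b ->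
  (forall s t, s <= a -> a <= b -> b < t -> al (s, t) <= clamp a - c) ->
  (forall s t, t <= b -> b <= a -> a < s -> al (s, t) <= clamp b - c) ->
  c <= metro_copula a b.
Proof.
move=> c0 ca cb up down; set Q := [set e | e.1 <= a /\ metro al e <= b].
have mQ : measurable Q by exact: (measurable_quadrant fst_pres rho_pres a b).
have mN x : measurable [set e : R * (R * R) | e.2.2 < x].
  by apply: measurable_lt_fun; [measurable_proj|exact: measurable_cst].
(* [Q] is a ray event of mass [clamp x] minus a part inside a noise event of mass [clamp x - c]. The
   ray concerns the old state if [a <= b] and the new state otherwise; with this choice a rejected
   move never leaves [Q]. *)
have key X (x : R) : meas_pres m nu X -> Q `<=` [set e | X e <= x] ->
    c <= clamp x ->
    [set e | X e <= x] `\` Q `<=` [set e | e.2.2 < clamp x - c] ->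
    c <= metro_copula a b.
  move=> mpX QX Cx sub; have [mX EX] := ray_law x mpX.
  set A := [set e | X e <= x] in QX sub mX EX.
  rewrite -lee_fin /metro_copula -(law_copulaE fst_pres rho_pres) -/Q.
  have : (m (A `\` Q) <= (clamp x - c)%:E)%E.
    rewrite -noise_law ?le_measure// ?inE//; first exact: measurableD.
    by rewrite subr_ge0 Cx/= lerBlDr (le_trans (clamp_le1 x))// lerDl.
  rewrite [leLHS](probabilityD m mX mQ QX) EX.
  by rewrite -[m Q]fineK ?fin_num_measure// -EFinB !lee_fin; lra.
have [ab|/ltW ba] := leP a b.
  apply: (key _ a fst_pres) => //; first by move=> e [].
  move=> [u [v z]] /= [ua nQ].
  have : b < metro al (u, (v, z)) by rewrite ltNge; apply/negP => h; apply: nQ.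
  rewrite /metro /=; case: ifPn => [h bv|_ bu].
    exact: lt_le_trans h (up _ _ ua ab bv).
  by have := lt_le_trans bu (le_trans ua ab); rewrite ltxx.
apply: (key _ b rho_pres) => //; first by move=> e [].
move=> [u [v z]] /= [ub nQ].
have : a < u by rewrite ltNge; apply/negP => h; apply: nQ.
move: ub; rewrite /metro /=; case: ifPn => [h vb au|_ ub au].
  exact: lt_le_trans h (down _ _ vb ba au).
by have := lt_le_trans au (le_trans ub ba); rewrite ltxx.
Qed.

(** Every proposal from []lo, q]] to []q, hi]] is accepted as soon as the noise is below 1, so a
    mass of at least [(q - lo) * (hi - q)] crosses [q]. *)
Lemma metro_gap_gt0 lo q hi : 0 <= lo -> lo < q -> q < hi -> hi <= 1 ->
  (forall u v, lo < u <= q -> q < v <= hi -> al (u, v) = 1) ->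
  metro_copula q q < q.
Proof.
move=> lo0 loq qhi hi1 al1; set Q := [set e | e.1 <= q /\ metro al e <= q].
have mQ : measurable Q by exact: (measurable_quadrant fst_pres rho_pres q q).
pose A := [set e : R * (R * R) | e.1 <= q].
have [mA EA] : measurable A /\ m A = (clamp q)%:E := ray_law q fst_pres.
have QA : Q `<=` A by move=> e [].
have q01 : clamp q = q by rewrite clamp_id//; apply/andP; split; lra.
pose I := `]lo, q]%classic : set R; pose J := `]q, hi]%classic : set R.
pose L := `]-oo, 1[%classic : set R.
have mI : measurable I by exact: measurable_itv.
have mJ : measurable J by exact: measurable_itv.
have mL : measurable L by exact: measurable_itv.
have mJL : measurable (J `*` L) by exact: measurableX.
have mB : measurable (I `*` (J `*` L)) by exact: measurableX.
have EB : m (I `*` (J `*` L)) = ((q - lo) * (hi - q))%:E.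
  rewrite [LHS]product_measure1E// [X in (_ * X)%E]product_measure1E//.
  rewrite [X in (X * _)%E]unif_itvoc ?(ltW loq)//.
  rewrite [X in (_ * (X * _))%E]unif_itvoc ?(ltW qhi)//.
  rewrite [X in (_ * (_ * X))%E]unif_itvNyo !clamp_id ?lexx ?ler01 ?mule1 -?EFinM//;
    by apply/andP; split; lra.
have BA : I `*` (J `*` L) `<=` A `\` Q.
  move=> [u [v z]] [/=]; rewrite /I /J /L /= !in_itv /= => uI [vJ z1].
  have /andP[_ uq] := uI; have /andP[qv _] := vJ.
  by split => // -[_]; rewrite /metro /= al1// z1 leNgt qv.
have : (m (I `*` (J `*` L)) <= m (A `\` Q))%E.
  by rewrite le_measure// inE//; exact: measurableD.
rewrite [leRHS](probabilityD m mA mQ QA) EA EB q01.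
rewrite [m Q](law_copulaE fst_pres rho_pres) -EFinB lee_fin -/metro_copula.
have : 0 < (q - lo) * (hi - q) by rewrite mulr_gt0 ?subr_gt0.
by move: (_ * _) => X; lra.
Qed.

End metropolis_copula.

(** * Diversification *)

Lemma bounded_Lfun d (T : measurableType d) (R : realType) (P : probability T R)
  (X : T -> R) M : measurable_fun setT X -> (forall t, `|X t| <= M) ->
  X \in Lfun P +oo%E.
Proof.
move=> mX XM; rewrite inE; apply/andP; split; rewrite inE//=.
rewrite /finite_norm unlock /Lnorm; case: ifPn => _; last exact: ltry.
apply: (@le_lt_trans _ _ M%:E); last exact: ltry.
by apply/ess_supP; apply: nearW => t /=; rewrite lee_fin.
Qed.

Lemma bm_chebyshev d (T : measurableType d) (R : realType) (P : probability T R)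
    (f : T -> R) e : bounded_meas f -> 0 < e ->
  (P [set t | (e < `|f t|)%R] <= ((e ^+ 2)^-1 * \int[P]_t (f t ^+ 2))%R%:E)%E.
Proof.
move=> bf e0; have mA : measurable [set t | e < `|f t|].
  by apply: measurable_lt_fun; [exact: measurable_cst|case: (bm_norm bf)].
rewrite bm_int_indic// lee_fin ler_pdivlMl ?exprn_gt0//.
have bA := bm_indic R mA.
rewrite -(bm_intZ _ _ bA); apply: bm_int_le.
- by apply: bmM => //; exact: bm_cst.
- exact: bm_sqr.
move=> t; rewrite indicE; case: (boolP (t \in _)) => [|_]; last by rewrite mulr0 sqr_ge0.
rewrite inE /= => et; rewrite mulr1 -(real_normK (num_real (f t))).
by rewrite lerXn2r ?nnegrE ?normr_ge0 ?(ltW e0) ?(ltW et).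
Qed.

Lemma meas_pres_map1 d1 d2 d3 (T1 : measurableType d1) (T2 : measurableType d2)
    (T3 : measurableType d3) (R : realType) (m1 : probability T1 R)
    (m2 : probability T2 R) (m3 : probability T3 R) (f : T1 -> T2) :
  meas_pres m1 m2 f ->
  meas_pres (mprod m1 m3) (mprod m2 m3) (fun p => (f p.1, p.2)).
Proof.
move=> mpf; have mh : measurable_fun setT (fun p : T1 * T3 => (f p.1, p.2)).
  apply: measurable_fun_pair => //; exact: (measurableT_comp (proj1 mpf)).
apply: meas_pres_int => // F bF; have bFh := bm_comp mh bF.
rewrite (bm_fubini2 _ _ bFh) (bm_fubini2 _ _ bF); apply: eq_Rintegral => y _.
exact: (bm_int_pres mpf (bm_pair2 y bF)).
Qed.

Lemma meas_pres_map2 d1 d2 d3 (T1 : measurableType d1) (T2 : measurableType d2)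
    (T3 : measurableType d3) (R : realType) (m1 : probability T1 R)
    (m2 : probability T2 R) (m3 : probability T3 R) (f : T1 -> T2) :
  meas_pres m1 m2 f ->
  meas_pres (mprod m3 m1) (mprod m3 m2) (fun p => (p.1, f p.2)).
Proof.
move=> mpf; have mh : measurable_fun setT (fun p : T3 * T1 => (p.1, f p.2)).
  apply: measurable_fun_pair => //; exact: (measurableT_comp (proj1 mpf)).
apply: meas_pres_int => // F bF; have bFh := bm_comp mh bF.
rewrite (bm_fubini1 _ _ bFh) (bm_fubini1 _ _ bF); apply: eq_Rintegral => y _.
exact: (bm_int_pres mpf (bm_pair1 y bF)).
Qed.

Lemma continuous_clamp (R : realType) : continuous (@clamp R).
Proof.
apply: lip1_continuous => x y xy; rewrite ger0_norm ?clamp_lip//.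
by rewrite subr_ge0 clamp_le.
Qed.

Section diversification.
Context d (T : measurableType d) (R : realType) (P : probability T R).
Hypothesis hP : atomless P.
Let nu := unif R.
Variable C : R -> R -> R.
Hypothesis hC : copula2 C.
Hypothesis gap : forall p, 0 < p < 1 -> 0 < diag_gap C p.

Let al (q : R * R) : R := Num.min (diag_gap C q.1) (diag_gap C q.2) - `|q.1 - q.2|.

Let mal : measurable_fun setT al.
Proof.
have mg : measurable_fun setT (diag_gap C).
  apply: continuous_measurable_fun; apply: lip1_continuous => x y.
  exact: diag_gap_lip.
apply: measurable_funB.
  by apply: measurable_minr; [exact: (measurableT_comp mg measurable_fst)
                             |exact: (measurableT_comp mg measurable_snd)].
by apply: measurableT_comp => //; apply: measurable_funB.
Qed.

Let sal u v : al (u, v) = al (v, u).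
Proof. by rewrite /al /= minC distrC. Qed.

Let al_le1 s t : al (s, t) <= diag_gap C s - `|s - t|.
Proof. by rewrite /al /= lerD2r ge_min lexx. Qed.

Let al_le2 s t : al (s, t) <= diag_gap C t - `|s - t|.
Proof. by rewrite /al /= lerD2r ge_min lexx orbT. Qed.

(** With $g$ the gap at [p], the gap is at least $3g/4$ within distance $g/4$ of [p], and two such
    points are at most $g/2$ apart; this leaves $g/4$ for [al]. *)
Let al_loc p : 0 < p < 1 -> exists2 r : R, 0 < r &
  forall u v : R, p - r <= u <= p + r -> p - r <= v <= p + r -> r <= al (u, v).
Proof.
move=> /gap g0; set g := diag_gap C p in g0; exists (g / 4); first by lra.
have near_p (u : R) : p - g / 4 <= u <= p + g / 4 -> 3 * (g / 4) <= diag_gap C u.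
  move=> /andP[u1 u2]; case: (leP p u) => [|/ltW] pu.
    have := diag_gap_lip hC pu; rewrite -/g ler_norml => /andP[]; lra.
  have := diag_gap_lip hC pu; rewrite -/g ler_norml => /andP[]; lra.
move=> u v Hu Hv; have gu := near_p u Hu; have gv := near_p v Hv.
have uv : `|u - v| <= 2 * (g / 4).
  by move: Hu Hv => /andP[? ?] /andP[? ?]; rewrite ler_norml; apply/andP; split; lra.
have : 3 * (g / 4) <= Num.min (diag_gap C u) (diag_gap C v) by rewrite le_min gu gv.
by rewrite /al /=; lra.
Qed.

Let C' := metro_copula al.

Let C'P : copula2 C'.
Proof. exact: metro_copulaP mal sal. Qed.

(** For $s\le a\le b<t$ the Lipschitz bound gives
    $\delta(s)-(t-s)\le\delta(a)-(t-a)\le\delta(a)-(b-a)$, and $C(a,b)\le C(a,a)+(b-a)$ bounds this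
    by [clamp a - C a b]. Crossings in the other direction are symmetric. *)
Let C_le : forall u v, C u v <= C' u v.
Proof.
move=> a b; apply: metro_copula_ge => //.
- exact: copula_ge0.
- exact: copula_le1.
- exact: copula_le2.
- move=> s t sa ab bt; apply: (le_trans (al_le1 s t)).
  have /andP[_] := copula_incr2 a hC ab; have := clamp_lip ab.
  have := diag_gap_lip hC sa; rewrite /diag_gap ler_norml => /andP[+ +].
  have := ler_norm (t - s); rewrite distrC; lra.
- move=> s t tb ba as_; apply: (le_trans (al_le2 s t)).
  have /andP[_] := copula_incr1 b hC ba; have := clamp_lip ba.
  have := diag_gap_lip hC tb; rewrite /diag_gap ler_norml => /andP[+ +].
  have := ler_norm (s - t); lra.
Qed.

Let rho_pres : meas_pres (mprod nu (mprod nu nu)) nu (metro al) :=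
  metro_pres nu nu mal sal.

(** [Z] turns a uniform point into two independent ones; applied again to the first of them it
    yields three: a proposal, an acceptance noise and the next driving variable. The pointwise bound
    keeps proposals in $[0,1]$. *)
Lemma driving_noise : exists th : R -> (R * R) * R,
  meas_pres nu (mprod (mprod nu nu) nu) th /\ forall w, 0 <= (th w).1.1 <= 1.
Proof.
have [Z [mpZ Z01]] := two_uniforms (@atomless_unif R).
exists ((fun p => (Z p.1, p.2)) \o Z); split; last by move=> w; have [] := Z01 (Z w).1.
exact: meas_pres_comp (meas_pres_map1 nu mpZ) mpZ.
Qed.

Lemma diversifiable_above :
  exists2 D, copula2 D /\ (forall u v, C u v <= D u v) & ~ non_diversifiable P D.
Proof.
exists C' => // ND.
have [th [mpth th01]] := driving_noise.
have [Z [mpZ Z01]] := two_uniforms hP.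
pose S := skew (metro al) th.
have mpS n : meas_pres (mprod nu nu) (mprod nu nu) (iter n S).
  exact: iter_skew_pres rho_pres mpth n.
have mpSZ n : meas_pres P (mprod nu nu) (iter n S \o Z) := meas_pres_comp (mpS n) mpZ.
pose Xf n t := (iter n S (Z t)).1.
have mpX n : meas_pres P nu (Xf n).
  exact: meas_pres_comp (meas_pres_fst nu nu) (mpSZ n).
have X01 n t : 0 <= Xf n t <= 1.
  have S01 p : 0 <= p.1 <= 1 -> 0 <= (S p).1 <= 1.
    by rewrite /S /skew /metro /=; case: ifP.
  elim: n => [|n IH]; first by have [] := Z01 t.
  by rewrite /Xf /=; apply: S01.
pose X n : {RV P >-> R} := HB.pack (Xf n) (isMeasurableFun.Build _ _ _ _ _ (proj1 (mpX n))).
have cdfX n x : cdf (X n) x = (clamp x)%:E.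
  rewrite -unif_itvNyc -(proj2 (mpX n))//; exact: measurable_itv.
have LX n : Linfty_cont (X n).
  split.
    apply: (@bounded_Lfun _ _ _ P (X n) 1); first exact: (proj1 (mpX n)).
    by move=> t; rewrite ger0_norm; have /andP[] := X01 n t.
  have -> : cdf (X n) = EFin \o @clamp R by apply/funext => x; exact: cdfX.
  move=> x; apply: cvg_EFin; first exact: nearW.
  exact: continuous_clamp.
have SX : seq_coupled C' X.
  move=> n; split.
    by move=> A mA; rewrite [LHS](proj2 (mpX n) A mA) [RHS](proj2 (mpX n.+1) A mA).
  move=> x y; rewrite !cdfX /= copula_clamp//.
  (* [q] keeps the state and decodes the present noise, so that [X n] and [X n.+1] are [fst] and
     [metro al] evaluated along [q]. *)
  pose q (p : R * R) : R * (R * R) := (p.1, (th p.2).1).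
  have mpq : meas_pres (mprod nu nu) (mprod nu (mprod nu nu)) q.
    apply: (meas_pres_map2 nu (f := fst \o th)).
    exact: meas_pres_comp (meas_pres_fst _ _) mpth.
  have mQ := measurable_quadrant (meas_pres_fst nu (mprod nu nu)) rho_pres x y.
  have mpqSZ := meas_pres_comp mpq (mpSZ n).
  rewrite -[RHS](law_copulaE (meas_pres_fst nu (mprod nu nu)) rho_pres x y).
  exact: (proj2 mpqSZ _ mQ).
apply: (ND X LX SX).
(* The identity is unbounded on the line; [clamp] agrees with it on the range of the chain and is a
   bounded observable. *)
pose mean := \int[nu]_u clamp u.
have bclamp : bounded_meas (@clamp R).
  split; first exact: continuous_measurable_fun (@continuous_clamp R).
  by exists 1 => x; rewrite ger0_norm ?clamp_le1 ?clamp_ge0.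
pose phi (u : R) := clamp u - mean.
have bphi : bounded_meas phi by apply: bmB => //; exact: bm_cst.
have phi0 : \int[nu]_u phi u = 0.
  by rewrite (bm_intB nu bclamp (bm_cst R mean)) int_cst subrr.
have EX : fine 'E_P[X 0%N] = mean.
  rewrite unlock -[LHS]/(\int[P]_w X 0%N w) /mean -(bm_int_pres (mpX 0%N) bclamp).
  by apply: eq_Rintegral => t _; rewrite clamp_id//; exact: X01.
have erg := chain_mean_ergodic mal sal al_loc mpth bphi phi0.
have phiX i t : phi (iter i S (Z t)).1 = X i t - mean.
  by rewrite /phi clamp_id//; exact: X01.
pose Y n (p : R * R) := n.+1%:R^-1 * \sum_(i < n.+1) phi (iter i S p).1.
have bY n : bounded_meas (Y n).
  apply: bmM; first exact: bm_cst.
  apply: bm_sum => i; apply: (bm_comp (h := fst \o iter i S)) bphi.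
  exact: measurable_iter_skew rho_pres mpth i.
have YX n t : n.+1%:R^-1 * (\sum_(i < n.+1) X i t) - fine 'E_P[X 0%N] - cst 0 t = Y n (Z t).
  rewrite /Y EX /= subr0; under [in RHS]eq_bigr do rewrite phiX.
  rewrite sumrB sumr_const card_ord mulrBr -[mean *+ _]mulr_natl.
  by rewrite [in X in _ = _ - X]mulrA mulVf ?mul1r// pnatr_eq0.
move=> e e0.
have lim0 : (fun n => ((e ^+ 2)^-1 *
    \int[mprod nu nu]_p (Y n p ^+ 2))%:E) @ \oo --> 0%E.
  apply: cvg_EFin; first exact: nearW.
  by rewrite -(mulr0 (e ^+ 2)^-1); apply: cvgMr.
apply: (@squeeze_cvge _ _ _ _ (fun=> 0%E) _ _ _ _ _ lim0); last exact: cvg_cst.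
apply: nearW => n; rewrite measure_ge0 /=.
under eq_set do rewrite YX.
have bYZ := bm_comp (proj1 mpZ) (bY n).
apply: (le_trans (bm_chebyshev P bYZ e0)).
by rewrite (bm_int_pres mpZ (bm_sqr (bY n))).
Qed.

End diversification.

(** * Mixtures of copulas *)

Section mixture.
Context (R : realType).

Lemma cvg_copula_mixture (C : nat -> R -> R -> R) (lam : nat -> R) u v :
  (forall n, copula2 (C n)) -> (forall n, 0 <= lam n) ->
  series lam @ \oo --> (1 : R) -> cvgn (series (fun n => lam n * C n u v)).
Proof.
move=> hC lam0 lam1; apply: (@series_le_cvg _ _ lam) => //.
- by move=> n; rewrite mulr_ge0// copula_ge0.
- move=> n; rewrite ler_piMr//.
  by rewrite (le_trans (copula_le1 u v (hC n)))// clamp_le1.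
- by apply/cvg_ex; exists 1.
Qed.

Lemma nneseries_EFin (f : nat -> R) : cvgn (series f) ->
  (\sum_(0 <= n <oo) (f n)%:E = (limn (series f))%:E)%E.
Proof.
move=> cf; rewrite -EFin_lim//; apply: congr_lim; apply/funext => n /=.
by rewrite sumEFin.
Qed.

Lemma mixture_copula (C : nat -> R -> R -> R) (lam : nat -> R) :
  (forall n, copula2 (C n)) -> (forall n, 0 <= lam n) ->
  series lam @ \oo --> (1 : R) ->
  copula2 (fun u v => limn (series (fun n => lam n * C n u v))).
Proof.
move=> hC lam0 lam1; have [mu Hmu] := choice hC.
pose m : {measure set (R * R) -> \bar R} :=
  mseries (fun n => mscale (NngNum (lam0 n)) (mu n)) 0.
have mE A : m A = (\sum_(0 <= n <oo) ((lam n)%:E * mu n A))%E by [].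
have const A (r : R) : (forall n, mu n A = r%:E) -> m A = r%:E.
  move=> H; rewrite mE; under eq_eseriesr do rewrite H -EFinM.
  have c1 : series (fun n => lam n * r) @ \oo --> 1 * r.
    have -> : series (fun n => lam n * r) = (fun n => series lam n * r).
      by apply/funext => n; rewrite /series /= mulr_suml.
    exact: cvgMl.
  rewrite nneseries_EFin; last by apply/cvg_ex; eexists; exact: c1.
  by rewrite (cvg_lim (@Rhausdorff R) c1) mul1r.
have mT : m setT = 1%E by apply: const => n; exact: probability_setT.
(* [m] already has mass 1; normalisation only presents it as a probability, [mu 0] being the default
   for a degenerate mass. *)
pose p : probability (R * R)%type R := mnormalize m (mu 0%N).
have pE A : p A = m A.
  rewrite /p /= /mnormalize [m setT]mT /= onee_eq0 /=.
  by rewrite invr1 mule1.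
exists p; split.
- move=> A mA; rewrite pE -unifE -[RHS]fineK ?fin_num_measure//.
  apply: const => n; have [H _ _] := Hmu n.
  by rewrite H// -unifE fineK// fin_num_measure.
- move=> A mA; rewrite pE -unifE -[RHS]fineK ?fin_num_measure//.
  apply: const => n; have [_ H _] := Hmu n.
  by rewrite H// -unifE fineK// fin_num_measure.
- move=> u v; rewrite pE mE -nneseries_EFin; last exact: cvg_copula_mixture.
  by apply: eq_eseriesr => n _; have [_ _ ->] := Hmu n.
Qed.

End mixture.

Section geometric_mixture.
Context (R : realType).

Definition half_weight (n : nat) : R := 2^-1 * 2^-1 ^+ n.

Lemma half_weight_gt0 n : 0 < half_weight n.
Proof. by rewrite mulr_gt0 ?exprn_gt0 ?invr_gt0 ?ltr0n. Qed.

Lemma half_weight_series : series half_weight @ \oo --> (1 : R).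
Proof.
have h : `|2^-1| < 1 :> R.
  by rewrite ger0_norm ?invr_ge0 ?ler0n// invf_lt1 ?ltr1n ?ltr0n.
have := @cvg_geometric_series R 2^-1 2^-1 h.
have -> // : 2^-1 * (1 - 2^-1)^-1 = 1 :> R.
have -> : 1 - 2^-1 = 2^-1 :> R by lra.
by rewrite divff// invr_eq0 pnatr_eq0.
Qed.

(** The gap of the mixture is the mixture of the gaps, all of them nonnegative, and the [k]-th one
    has positive weight. *)
Lemma mixture_gap (C : nat -> R -> R -> R) k p :
  (forall n, copula2 (C n)) -> 0 < diag_gap (C k) p ->
  0 < diag_gap (fun u v => limn (series (fun n => half_weight n * C n u v))) p.
Proof.
move=> hC gk; rewrite /diag_gap.
have hw n : 0 <= half_weight n by exact/ltW/half_weight_gt0.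
have cC := @cvg_copula_mixture _ _ _ p p hC hw half_weight_series.
pose g n := half_weight n * diag_gap (C n) p.
have cg : series g @ \oo -->
    clamp p - limn (series (fun n => half_weight n * C n p p)).
  have -> : series g = fun n => clamp p * series half_weight n
      - series (fun n => half_weight n * C n p p) n.
    apply/funext => n; rewrite /series /= mulr_sumr -sumrB.
    by apply: eq_bigr => i _; rewrite /g /diag_gap; ring.
  rewrite -[X in _ --> X - _]mulr1; apply: cvgB => //.
  by apply: cvgMr; exact: half_weight_series.
rewrite -(cvg_lim (@Rhausdorff R) cg).
apply: (@lt_le_trans _ _ (g k)); first by rewrite mulr_gt0// half_weight_gt0.
apply: limr_ge; first by apply/cvg_ex; eexists; exact: cg.
near=> n; rewrite /series /=.
have kn : (k < n)%N by near: n; exact: nbhs_infty_gt.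
rewrite big_mkord (bigD1 (Ordinal kn)) //= lerDl sumr_ge0// => i _.
by rewrite mulr_ge0// diag_gap_ge0.
Unshelve. all: by end_near. Qed.

(** A Lindelöf argument made explicit: for each rational point and rational height one copula is
    chosen whose gap at the point exceeds the height, if there is one in [D]. *)
Lemma countable_gap (D : set (R -> R -> R)) : D !=set0 ->
  (forall C, D C -> copula2 C) ->
  (forall p, 0 < p < 1 -> exists2 C, D C & 0 < diag_gap C p) ->
  exists C : nat -> R -> R -> R, (forall n, D (C n)) /\
    forall p, 0 < p < 1 -> exists k, 0 < diag_gap (C k) p.
Proof.
move=> [C0 D0] Dcop Dgap.
have sel (x : rat * rat) : exists C, D C /\
    ((exists2 C', D C' & ratr x.2 < diag_gap C' (ratr x.1)) ->
     ratr x.2 < diag_gap C (ratr x.1) :> R).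
  have [[C' DC' h]|nex] := pselect (exists2 C', D C' &
    ratr x.2 < diag_gap C' (ratr x.1) :> R); first by exists C'.
  by exists C0.
have [F HF] := choice sel.
(* Integers that encode no pair receive the default [C0]. *)
exists (fun n => if unpickle n is Some x then F x else C0); split.
  by move=> n; case: (unpickle n) => // x; have [] := HF x.
move=> p /Dgap [C DC]; set g := diag_gap C p => g0.
have [q] : exists q : rat, ratr q \in `]p, p + g / 4[.
  (* With $q-p<g/4<r<g/2$, the gap of [C] at $q$ still exceeds $r$, so the chosen copula has gap
     above $r$ at $q$, and the Lipschitz bound keeps it positive at $p$. *)
  by apply: rat_in_itvoo; lra.
rewrite in_itv /= => /andP[pq qp].
have [r] : exists r : rat, ratr r \in `]g / 4, g / 2[.
  by apply: rat_in_itvoo; lra.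
rewrite in_itv /= => /andP[gr rg].
exists (pickle (q, r)); rewrite pickleK.
have [DF /(_ _)] := HF (q, r); rewrite /= => H.
have {}H : ratr r < diag_gap (F (q, r)) (ratr q).
  apply: H; exists C => //.
  have := diag_gap_lip (Dcop _ DC) (ltW pq); rewrite -/g ler_norml => /andP[]; lra.
have := diag_gap_lip (Dcop _ DF) (ltW pq); rewrite ler_norml => /andP[]; lra.
Qed.

End geometric_mixture.


(** * Concentration classes *)

Lemma DclassE (R : realType) (p : R) C : 0 < p < 1 -> copula2 C ->
  Dclass p C <-> diag_gap C p = 0.
Proof.
move=> /andP[p0 p1] hC; rewrite /diag_gap clamp_id; last by rewrite (ltW p0) (ltW p1).
split; first by move=> [_ ->]; rewrite subrr.
by move=> /eqP; rewrite subr_eq0 => /eqP h; split.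
Qed.

Section class_inclusion.
Context d (T : measurableType d) (R : realType) (P : probability T R).

Lemma bcc_sub_Dclass (D : set (R -> R -> R)) : atomless P ->
  bivariate_concentration_class P D ->
  exists2 p, 0 < p < 1 & D `<=` Dclass p.
Proof.
move=> hP bD; apply: contrapT => nex.
have h01 : ((0 : R) < 2^-1) && ((2^-1 : R) < 1).
  by rewrite invr_gt0 ltr0n invf_lt1 ?ltr0n ?ltr1n.
(* An empty class lies in every [Dclass p]; the point 1/2 is an arbitrary choice. *)
have D0 : D !=set0.
  apply/set0P/negP => /eqP D0; apply: nex; exists 2^-1 => //.
  by rewrite D0; exact: sub0set.
have Dgap p : 0 < p < 1 -> exists2 C, D C & 0 < diag_gap C p.
  move=> p01; apply: contrapT => nC; apply: nex; exists p => // C DC.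
  have hC := bcc_copula bD DC; apply/(DclassE p01 hC)/eqP.
  rewrite eq_le diag_gap_ge0// andbT leNgt; apply/negP => g0.
  by apply: nC; exists C.
have [C [DC gC]] := countable_gap D0 (bcc_copula bD) Dgap.
have hC n := bcc_copula bD (DC n).
have hw n : 0 <= half_weight R n by exact/ltW/half_weight_gt0.
have Dmix := bcc_Cx bD DC hw (@half_weight_series R).
have [|E [hE leE] nE] := diversifiable_above hP (bcc_copula bD Dmix).
  by move=> p /gC [k gk]; exact: (mixture_gap hC gk).
by apply: nE; apply: (bcc_ND bD); exact: (bcc_DM bD Dmix hE leE).
Qed.

End class_inclusion.

(** A Metropolis step that always accepts on the same side of [p] and never across [p] has its
    copula in [Dclass p]. For any other [q], accepted moves between [q] and the block boundaries
    carry mass across [q]. *)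
Lemma Dclass_sep (R : realType) (p q : R) : 0 < p < 1 -> 0 < q < 1 ->
  Dclass p `<=` Dclass q -> p = q.
Proof.
move=> p01 q01 sub; apply/eqP/negPn/negP => pq.
pose A := `]-oo, p]%classic : set R.
have mA : measurable A by exact: measurable_itv.
pose al (x : R * R) : R :=
  \1_A x.1 * \1_A x.2 + \1_(~` A) x.1 * \1_(~` A) x.2.
have mal : measurable_fun setT al.
  have b1 := bm_indic R mA; have b2 := bm_indic R (measurableC mA).
  apply: bm_meas; apply: bmD; apply: bmM.
  - exact: bm_comp measurable_fst b1.
  - exact: bm_comp measurable_snd b1.
  - exact: bm_comp measurable_fst b2.
  - exact: bm_comp measurable_snd b2.
have sal u v : al (u, v) = al (v, u) by rewrite /al /=; ring.
have iA x : \1_A x = (x <= p)%R%:R :> R.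
  by rewrite indicE; congr ((nat_of_bool _)%:R); apply/idP/idP; rewrite inE /A /= in_itv.
have iC x : \1_(~` A) x = (~~ (x <= p)%R)%:R :> R.
  rewrite indicE in_setC; congr ((nat_of_bool (~~ _))%:R).
  by apply/idP/idP; rewrite inE /A /= in_itv.
have hC : copula2 (metro_copula al) := metro_copulaP mal sal.
have cl (x : R) : 0 < x < 1 -> clamp x = x.
  by move=> /andP[x0 x1]; rewrite clamp_id// (ltW x0) (ltW x1).
have Cp : Dclass p (metro_copula al).
  split => //; apply/eqP; rewrite eq_le; apply/andP; split.
    by have := copula_le1 p p hC; rewrite (cl p p01).
  have /andP[p0 p1] := p01.
  apply: metro_copula_ge; rewrite ?cl ?(ltW p0)// => s t.
  - by move=> sp _ pt; rewrite /al /= !iA !iC sp (lt_geF pt) /=; lra.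
  - by move=> tp _ ps; rewrite /al /= !iA !iC tp (lt_geF ps) /=; lra.
have [_] := sub _ Cp; have /andP[p0 p1] := p01; have /andP[q0 q1] := q01.
suff : metro_copula al q q < q by move=> + E; rewrite E ltxx.
case: (ltgtP p q) pq => // pq _.
  apply: (@metro_gap_gt0 _ _ mal sal p q 1) => //; first exact: ltW.
  move=> u v /andP[pu _] /andP[qv _]; rewrite /al /= !iA !iC (lt_geF pu).
  by rewrite (lt_geF (lt_trans pq qv)) /=; lra.
apply: (@metro_gap_gt0 _ _ mal sal 0 q p) => //; first exact: ltW.
move=> u v /andP[_ uq] /andP[_ vp]; rewrite /al /= !iA !iC vp.
by rewrite (le_trans uq (ltW pq)) /=; lra.
Qed.

(** * Non-diversifiability of the members of [Dclass p] *)

Section non_diversifiable_Dclass.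
Context d (T : measurableType d) (R : realType) (P : probability T R).

Lemma int_eq0_measure0 (f : T -> R) : bounded_meas f -> (forall t, 0 <= f t) ->
  \int[P]_t f t = 0 -> P [set t | 0 < f t] = 0%E.
Proof.
move=> bf f0 If; have mf := bm_meas bf.
have mA : measurable [set t | 0 < f t].
  by apply: measurable_lt_fun => //; exact: measurable_cst.
have I0 : (\int[P]_t `|(f t)%:E| = 0)%E.
  under eq_integral => t _ do rewrite gee0_abs ?lee_fin//.
  by rewrite bm_intE// If.
have /ae_eq_integral_abs : measurable_fun setT (EFin \o f) by exact/measurable_EFinP.
move=> /(_ P measurableT)[+ _] => /(_ I0) [N [mN N0 sN]].
apply: (subset_measure0 mA mN) => // t /= ft.
by apply: sN => /= /(_ I) [] ft0; move: ft; rewrite ft0 ltxx.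
Qed.

Variable X : nat -> {RV P >-> R}.
Hypothesis Xlaw : forall n, eq_in_law (X n) (X n.+1).

Lemma law0 n A : measurable A -> P (X n @^-1` A) = P (X 0%N @^-1` A).
Proof.
move=> mA; elim: n => // n <-; exact: (esym (@Xlaw n A mA)).
Qed.

Lemma bm_int_law (g : R -> R) n : bounded_meas g ->
  \int[P]_t g (X n t) = \int[P]_t g (X 0%N t).
Proof.
move=> bg; have mp k : meas_pres P (distribution P (X 0%N)) (X k).
  by split => //; move=> A mA; exact: law0.
by rewrite (bm_int_pres (mp n) bg) (bm_int_pres (mp 0%N) bg).
Qed.

Lemma Linfty_bound (Y : {RV P >-> R}) : Linfty_cont Y ->
  exists2 M, 0 < M & P [set t | M < `|Y t|] = 0%E.
Proof.
move=> [+ _]; rewrite inE => /andP[_]; rewrite inE /= /finite_norm unlock /Lnorm.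
rewrite [X in (0 < X)%E]probability_setT lte01 => Yoo.
have [M M0 YM] : exists2 M, 0 < M & (ess_sup P (abse \o (EFin \o Y)) <= M%:E)%E.
  case: (ess_sup _ _) Yoo => [r _|//|_]; last by exists 1; rewrite ?leNye.
  exists (Num.max 1 r); first by rewrite lt_max ltr01.
  by rewrite lee_fin le_max lexx orbT.
exists M => //; move/ess_supP : YM => [N [mN N0 sN]].
have mA : measurable [set t | M < `|Y t|].
  apply: measurable_lt_fun; first exact: measurable_cst.
  by apply: measurableT_comp.
apply: (subset_measure0 mA mN) => // t /= Mt; apply: sN => /=.
by apply/negP; rewrite lee_fin -ltNge.
Qed.

End non_diversifiable_Dclass.

Section frozen_event.
Context d (T : measurableType d) (R : realType) (P : probability T R).
Variable p : R.
Hypothesis p01 : 0 < p < 1.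
Variables (C : R -> R -> R) (X : nat -> {RV P >-> R}).
Hypothesis Cp : C p p = p.
Hypothesis LX : forall n, Linfty_cont (X n).
Hypothesis SX : seq_coupled C X.

Variable M : R.
Hypothesis M0 : 0 < M.
Hypothesis XM : P [set t | M < `|X 0%N t|] = 0%E.

Let Xlaw n : eq_in_law (X n) (X n.+1) := proj1 (SX n).

Let mX n : measurable_fun setT (X n : T -> R).
Proof. exact: measurable_funPT. Qed.

Let mXn n (A : set R) : measurable A -> measurable (X n @^-1` A).
Proof. by move=> mA; rewrite -[X in measurable X]setTI; exact: mX. Qed.

Lemma XM_law n : P [set t | M < `|X n t|] = 0%E.
Proof.
rewrite -XM; have mA : measurable [set x : R | M < `|x|].
  by apply: measurable_lt_fun; [exact: measurable_cst|exact: normr_measurable].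
exact: (law0 Xlaw n mA).
Qed.

(** The intermediate value theorem applies to the continuous distribution function. The bound
    [q < M] is strict because the function is already 1 at [M]; it ensures that clipping at [M]
    keeps values above [q] above [q]. *)
Lemma bounded_quantile : exists q, [/\ cdf (X 0%N) q = p%:E, - M <= q & q < M].
Proof.
pose F x := fine (cdf (X 0%N) x).
have cdfE x : cdf (X 0%N) x = (F x)%:E.
  by rewrite fineK// /cdf fin_num_measure//; exact: measurable_itv.
have cF : continuous F by move=> x; apply: fine_cvg; rewrite -cdfE; exact: (proj2 (LX 0)).
have mB : measurable [set t | M < `|X 0%N t|].
  by apply: measurable_lt_fun; [exact: measurable_cst|exact: measurableT_comp].
have F0 x : x < - M -> F x = 0.
  move=> xM; apply: EFin_inj; rewrite -cdfE.
  apply: (subset_measure0 (mXn 0 (measurable_itv _)) mB _ XM) => t /=.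
  rewrite in_itv /= => tx; rewrite ltrNr in xM.
  by rewrite -normrN (lt_le_trans xM)// (le_trans _ (ler_norm _))// lerN2.
have FM : F M = 1.
  apply: EFin_inj; rewrite -cdfE.
  have mC : measurable (X 0%N @^-1` `]-oo, M]%classic) := mXn 0 (measurable_itv _).
  have : P (~` (X 0%N @^-1` `]-oo, M]%classic)) = 0%E.
    apply: (subset_measure0 (measurableC mC) mB _ XM) => t /=.
    rewrite in_itv /= => /negP; rewrite -ltNge => h.
    exact: lt_le_trans h (ler_norm _).
  rewrite probability_setC// => /eqP.
  by rewrite sube_eq ?add0e ?fin_num_measure// => /eqP h; exact: (esym h).
have /andP[p0 p1] := p01.
have M0' := M0; have lo : F (- M - 1) = 0 by apply: F0; lra.
have [q] : exists2 q, q \in `[(- M - 1), M] & F q = p.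
  apply: IVT; first lra.
    exact: continuous_subspaceT.
  by rewrite lo FM min_l ?max_r ?ler01 ?(ltW p0) ?(ltW p1).
rewrite in_itv /= => /andP[_ qM] Fq; exists q; split; first by rewrite cdfE Fq.
  by rewrite leNgt; apply/negP => /F0; lra.
by rewrite lt_neqAle qM andbT; apply/eqP => E; move: Fq; rewrite E FM; lra.
Qed.

Variable q : R.
Hypothesis Fq : cdf (X 0%N) q = p%:E.
Hypothesis Mq : - M <= q < M.

Let below : R -> R := \1_(`]-oo, q]%classic).
(** The variables are bounded only almost surely; clipping makes them bounded everywhere and changes
    them on null sets alone. *)
Let clip (x : R) : R := Num.max (- M) (Num.min x M).

Let belowE x : below x = (x <= q)%R%:R.
Proof.
rewrite /below indicE; congr ((nat_of_bool _)%:R).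
by apply/idP/idP; rewrite inE /= in_itv.
Qed.

Let bbelow : bounded_meas below.
Proof. by apply: bm_indic; exact: measurable_itv. Qed.

Let clip_bound x : `|clip x| <= M.
Proof.
have M0' := M0; rewrite /clip ler_norml le_max lexx /= ge_max ge_min lexx orbT andbT.
by lra.
Qed.

Let bclip : bounded_meas clip.
Proof.
split; last by exists M.
apply: measurable_maxr; first exact: measurable_cst.
by apply: measurable_minr; [exact: measurable_id|exact: measurable_cst].
Qed.

Let bX (g : R -> R) n : bounded_meas g -> bounded_meas (fun t => g (X n t)).
Proof. exact: bm_comp (mX n). Qed.

Let int_below n : \int[P]_t below (X n t) = p.
Proof.
rewrite (bm_int_law Xlaw)//; apply: EFin_inj; rewrite -Fq.
rewrite -[RHS]/(P (X 0%N @^-1` `]-oo, q]%classic)).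
rewrite bm_int_indic//; exact: mXn (measurable_itv _).
Qed.

Let cdfq n : cdf (X n) q = p%:E.
Proof. by rewrite -Fq; exact: (law0 Xlaw n (measurable_itv _)). Qed.

(** Sklar's relation at [(q, q)], where both distribution functions equal [p], reads off [C p p]. *)
Let int_below2 n : \int[P]_t (below (X n t) * below (X n.+1 t)) = p.
Proof.
have mQ : measurable [set t | X n t <= q /\ X n.+1 t <= q].
  have -> : [set t | X n t <= q /\ X n.+1 t <= q] =
      X n @^-1` `]-oo, q]%classic `&` X n.+1 @^-1` `]-oo, q]%classic.
    by apply/seteqP; split => t /=; rewrite !in_itv.
  by apply: measurableI; apply: mXn; exact: measurable_itv.
have := bm_int_indic P mQ.
have H := proj2 (SX n) q q; rewrite (cdfq n) (cdfq n.+1) /= Cp in H.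
rewrite [LHS]H => E; rewrite [RHS](EFin_inj E).
apply: eq_Rintegral => t _; rewrite !belowE indicE -natrM mulnb.
by congr ((nat_of_bool _)%:R); apply/andP/idP; rewrite inE.
Qed.

(** For indicators $|x-y|=x+y-2xy$, so consecutive ones differ in mean by $p+p-2p=0$; the triangle
    inequality links [n] to 0. *)
Let below_frozen n : \int[P]_t `|below (X n t) - below (X 0%N t)| = 0.
Proof.
have step k : \int[P]_t `|below (X k.+1 t) - below (X k t)| = 0.
  have b1 := bX k bbelow; have b2 := bX k.+1 bbelow; have b3 := bmM b1 b2.
  have b4 := bmM (bm_cst T (- 2)) b3.
  transitivity (\int[P]_t ((below (X k t) + below (X k.+1 t))
      + - 2 * (below (X k t) * below (X k.+1 t)))).
    apply: eq_Rintegral => t _; rewrite !belowE.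
    by case: (X k t <= q)%R; case: (X k.+1 t <= q)%R;
      rewrite ?subrr ?subr0 ?sub0r ?normrN ?normr1 ?normr0 /=; ring.
  rewrite (bm_intD _ (bmD b1 b2) b4) (bm_intD _ b1 b2) bm_intZ// !int_below int_below2.
  by ring.
elim: n => [|n IH].
  by under eq_Rintegral do rewrite subrr normr0; rewrite int_cst.
have b0 := bX 0 bbelow; have b1 := bX n bbelow; have b2 := bX n.+1 bbelow.
have c1 := bm_norm (bmB b2 b1); have c2 := bm_norm (bmB b1 b0).
apply/eqP; rewrite eq_le; apply/andP; split; last by apply: bm_int_ge0.
rewrite -[leRHS](addr0 0) -{1}(step n) -IH -(bm_intD _ c1 c2).
apply: bm_int_le; [exact/bm_norm/bmB|exact: bmD|] => t.
by rewrite (le_trans _ (ler_normD _ _))// addrA subrK.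
Qed.

Let K := \int[P]_t (clip (X 0%N t) * below (X 0%N t)).
Let mu := \int[P]_t clip (X 0%N t).

(** The indicator at time 0 may be replaced by the one at time [n], after which only the law of
    [X n] matters. *)
Let int_clip_below n : \int[P]_t (clip (X n t) * below (X 0%N t)) = K.
Proof.
have b0 := bX 0 bbelow; have bn := bX n bbelow; have cn := bX n bclip.
have E : \int[P]_t (clip (X n t) * below (X n t)) = K.
  exact: (bm_int_law Xlaw n (bmM bclip bbelow)).
rewrite -E; apply/eqP; rewrite -subr_eq0 -bm_intB; [|exact: bmM|exact: bmM].
rewrite -normr_eq0 eq_le normr_ge0 andbT.
have bd := bmB (bmM cn b0) (bmM cn bn).
apply: (le_trans (bm_int_abs P bd)).
rewrite -(mulr0 M) -(below_frozen n) -bm_intZ; last exact/bm_norm/bmB.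
apply: bm_int_le; first exact: bm_norm.
  by apply: bmM; [exact: bm_cst|exact/bm_norm/bmB].
by move=> t; rewrite -mulrBr normrM distrC ler_wpM2r.
Qed.

Let mean n t := n.+1%:R^-1 * (\sum_(i < n.+1) clip (X i t)) - mu.

Let bmean n : bounded_meas (mean n).
Proof.
apply: bmB; last exact: bm_cst.
by apply: bmM; [exact: bm_cst|apply: bm_sum => i; exact: bX].
Qed.

Let average_const n (k : R) : n.+1%:R^-1 * \sum_(i < n.+1) k = k.
Proof.
by rewrite sumr_const card_ord -[k *+ _]mulr_natl mulrA mulVf ?mul1r// pnatr_eq0.
Qed.

Let int_mean_below n : \int[P]_t (mean n t * below (X 0%N t)) = K - mu * p.
Proof.
have b0 := bX 0 bbelow.
have bi (i : 'I_n.+1) : bounded_meas (fun t => clip (X i t) * below (X 0%N t)).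
  by apply: bmM => //; exact: bX.
have bs := bm_sum (index_enum 'I_n.+1) bi.
have c1 := bmM (bm_cst T n.+1%:R^-1) bs; have c2 := bmM (bm_cst T mu) b0.
transitivity (\int[P]_t (n.+1%:R^-1 *
    (\sum_(i < n.+1) clip (X i t) * below (X 0%N t)) - mu * below (X 0%N t))).
  by apply: eq_Rintegral => t _; rewrite -mulr_suml /mean; ring.
rewrite (bm_intB _ c1 c2) (bm_intZ _ _ bs) (bm_intZ _ _ b0) int_below.
rewrite bm_int_sum//; congr (_ - _).
under eq_bigr do rewrite int_clip_below.
exact: average_const.
Qed.

Let mu_bound : `|mu| <= M.
Proof.
have b := bX 0 bclip; apply: (le_trans (bm_int_abs P b)).
rewrite -[leRHS](int_cst P); apply: bm_int_le => //; first exact: bm_norm.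
exact: bm_cst.
Qed.

Let mean_bound n t : `|mean n t| <= 2 * M.
Proof.
have H : `|n.+1%:R^-1 * (\sum_(i < n.+1) clip (X i t))| <= M.
  rewrite normrM ger0_norm ?invr_ge0// -[leRHS](average_const n).
  rewrite ler_wpM2l ?invr_ge0//; apply: (le_trans (ler_norm_sum _ _ _)).
  exact: ler_sum.
by apply: (le_trans (ler_normB _ _)); have := mu_bound; lra.
Qed.

Let null_meas n : measurable [set t | clip (X n t) != X n t].
Proof.
rewrite -[X in measurable X]setTI.
have -> : [set t | clip (X n t) != X n t] =
   (fun t => clip (X n t) == X n t) @^-1` [set false].
  by apply/seteqP; split => t /=; [move/negbTE|move=> ->].
by apply: (measurable_fun_eqr (bm_meas (bX n bclip)) (mX n)).
Qed.

Let null_ae n : P [set t | clip (X n t) != X n t] = 0%E.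
Proof.
have mA : measurable [set t | M < `|X n t|].
  by apply: measurable_lt_fun; [exact: measurable_cst|exact: measurableT_comp].
apply: (subset_measure0 (null_meas n) mA _ (XM_law n)) => t /= h.
rewrite ltNge; apply/negP => XtM; move/eqP: h; apply.
by move: XtM; rewrite ler_norml /clip => /andP[h1 h2]; rewrite min_l// max_r.
Qed.

Let expectation_clip : fine 'E_P[X 0%N] = mu.
Proof.
rewrite unlock /mu /Rintegral; congr fine.
apply: ae_eq_integral => //.
- by apply/measurable_EFinP.
- by apply/measurable_EFinP; exact: (bm_meas (bX 0 bclip)).
exists [set t | clip (X 0%N t) != X 0%N t].
split; [exact: null_meas|exact: null_ae|].
by move=> t /= H; apply/eqP => E; apply: H => _; rewrite E.
Qed.

(** Clipped and original averages agree outside one null set, the union over all times. *)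
Let mean_cvg : cvg_in_probability P
    (fun n t => n.+1%:R^-1 * (\sum_(i < n.+1) X i t) - fine 'E_P[X 0%N]) (cst 0) ->
  forall e, 0 < e -> (fun n => fine (P [set t | e < `|mean n t|])) @ \oo --> 0.
Proof.
move=> cv e e0; apply: fine_cvg.
pose B n := [set t | e < `|n.+1%:R^-1 * (\sum_(i < n.+1) X i t) - mu - 0|].
have cB : (fun n => P (B n)) @ \oo --> 0%E.
  by have := cv e e0; rewrite expectation_clip.
apply: (@squeeze_cvge _ _ _ _ (fun=> 0%E) _ _ _ _ _ cB); last exact: cvg_cst.
apply: nearW => n; rewrite measure_ge0 /=.
pose N := \bigcup_n [set t | clip (X n t) != X n t].
have mN : measurable N by exact: bigcupT_measurable.
have N0 : P N = 0%E.
  apply: measure_negligible => //; apply: negligible_bigcup => k.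
  by exists [set t | clip (X k t) != X k t]; split;
    [exact: null_meas|exact: null_ae|exact: subset_refl].
have mA : measurable [set t | e < `|mean n t|].
  by apply: measurable_lt_fun; [exact: measurable_cst|exact: (bm_meas (bm_norm (bmean n)))].
have mB : measurable (B n).
  apply: measurable_lt_fun; first exact: measurable_cst.
  apply: measurableT_comp => //; apply: measurable_funB => //.
  apply: measurable_funB => //; apply: measurable_funM => //.
  by apply: measurable_sum.
rewrite -(measureU0 mB mN N0); apply: le_measure; rewrite ?inE//.
  exact: measurableU.
move=> t /= et; have [Nt|Nt] := pselect (N t); first by right.
left; rewrite /B /= subr0; move: et; rewrite /mean.
congr (e < `|_ * _ - _|); apply: eq_bigr => i _; apply/eqP/negPn/negP => h.
by apply: Nt; exists (i : nat).
Qed.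

Lemma frozen_event_not_cvg : ~ cvg_in_probability P
    (fun n t => n.+1%:R^-1 * (\sum_(i < n.+1) X i t) - fine 'E_P[X 0%N]) (cst 0).
Proof.
move=> /mean_cvg cv; have M0' := M0; have /andP[p0 p1] := p01; have /andP[Mq1 Mq2] := Mq.
have b0 := bX 0 bbelow; have c0 := bX 0 bclip.
have KE : K = mu * p.
  apply/eqP; rewrite -subr_eq0 -normr_eq0 eq_le normr_ge0 andbT.
  apply/ler_addgt0Pr => e e0; rewrite add0r.
  (* The integral splits into the part where the mean is at most [a] and an event of probability
     below [a], on which the mean is at most $2M$; the total is $a+2Ma=e$. *)
  pose a := e / (1 + 2 * M).
  have M1 : 0 < 1 + 2 * M by lra.
  have a0 : 0 < a by rewrite divr_gt0.
  have aE : a + 2 * M * a = e.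
    rewrite /a; have M1' : 1 + 2 * M != 0 by rewrite gt_eqF.
    by field.
  move/cvgrPdist_lt : (cv a a0) => /(_ a a0) [n _ /(_ n (leqnn n))] /=.
  rewrite sub0r normrN ger0_norm; last by apply: fine_ge0; exact: measure_ge0.
  set A := [set t | a < `|mean n t|] => An.
  have mA : measurable A.
    by apply: measurable_lt_fun; [exact: measurable_cst|exact: (bm_meas (bm_norm (bmean n)))].
  have bA := bm_indic R mA.
  rewrite -(int_mean_below n) -aE.
  apply: (le_trans (bm_int_abs P (bmM (bmean n) b0))).
  apply: (@le_trans _ _ (a + 2 * M * \int[P]_t (\1_A t))); last first.
    rewrite lerD2l ler_wpM2l//; first by lra.
    by move: An; rewrite bm_int_indic//= => /ltW.
  have b2 := bmM (bm_cst T (2 * M)) bA.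
  rewrite -(bm_intZ _ _ bA) -[X in X + _](int_cst P) -(bm_intD _ (bm_cst T a) b2).
  apply: bm_int_le.
  - by apply: bm_norm; exact: bmM.
  - by apply: bmD => //; exact: bm_cst.
  move=> t; apply: (@le_trans _ _ `|mean n t|).
    by rewrite normrM ler_piMr// belowE; case: (_ <= q); rewrite ?normr1 ?normr0.
  rewrite indicE; case: (boolP (t \in A)) => tA.
    by rewrite mulr1; have := mean_bound n t; lra.
  by rewrite mulr0 addr0; move: tA; rewrite notin_setE /A /= => /negP; rewrite -leNgt.
have bq := bmM (bm_cst T q) b0.
have bK := bmM c0 b0.
have Kq : K <= q * p.
  rewrite /K -(int_below 0) -(bm_intZ _ _ b0); apply: bm_int_le => // t.
  rewrite belowE; case: (boolP (X 0%N t <= q)) => [h|_]; last by rewrite !mulr0.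
  by rewrite !mulr1 /clip ge_max Mq1 /= ge_min h.
have muq : mu <= q by move: Kq; rewrite KE ler_pM2r.
(* [W] is the positive part of [clip (X 0) - q]. Its integral is $(\mu-q)(1-p)\le 0$, so [X 0] is
   almost surely at most [q], although that event has probability $p<1$. *)
pose W t := (clip (X 0%N t) - q) - (clip (X 0%N t) * below (X 0%N t) - q * below (X 0%N t)).
have b1 := bmB c0 (bm_cst T q); have b2 := bmB bK bq.
have bW : bounded_meas W := bmB b1 b2.
have WE t : W t = if X 0%N t <= q then 0 else clip (X 0%N t) - q.
  by rewrite /W belowE; case: (X 0%N t <= q)%R => /=; ring.
have Wpos t : q < X 0%N t -> 0 < clip (X 0%N t) - q.
  by move=> h; rewrite subr_gt0 /clip lt_max lt_min h Mq2 orbT.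
have W0 t : 0 <= W t.
  by rewrite WE; case: (leP (X 0%N t) q) => // h; exact: (ltW (Wpos t h)).
have IW : \int[P]_t W t = (mu - q) - (K - q * p).
  rewrite /W (bm_intB _ b1 b2) (bm_intB _ c0 (bm_cst T q)) (bm_intB _ bK bq).
  by rewrite int_cst bm_intZ// int_below.
have IW0 : \int[P]_t W t = 0.
  apply/eqP; rewrite eq_le (bm_int_ge0 P W0) andbT IW KE.
  have -> : mu - q - (mu * p - q * p) = (mu - q) * (1 - p) by ring.
  by rewrite mulr_le0_ge0//; lra.
have := int_eq0_measure0 bW W0 IW0.
have -> : [set t | 0 < W t] = ~` (X 0%N @^-1` `]-oo, q]%classic).
  apply/seteqP; split => t /=; rewrite in_itv /= WE.
    by case: (leP (X 0%N t) q) => //; rewrite ltxx.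
  by case: (leP (X 0%N t) q) => // h _; exact: Wpos.
rewrite probability_setC; last exact: mXn (measurable_itv _).
rewrite [X in (_ - X)%E]Fq -EFinB => E; have := EFin_inj E; lra.
Qed.

End frozen_event.

Lemma Dclass_non_diversifiable d (T : measurableType d) (R : realType)
    (P : probability T R) (p : R) C : 0 < p < 1 -> Dclass p C -> non_diversifiable P C.
Proof.
move=> p01 [_ Cp] X LX SX.
have [M M0 XM] := Linfty_bound (LX 0%N).
have [q [Fq Mq qM]] := bounded_quantile p01 LX M0 XM.
by apply: (frozen_event_not_cvg p01 Cp SX M0 XM Fq); rewrite Mq.
Qed.

(** The value [p] is the largest that a copula can take at [(p, p)]; domination and mixtures both
    preserve attaining it. *)
Lemma Dclass_bcc d (T : measurableType d) (R : realType) (P : probability T R)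
  (p : R) : 0 < p < 1 -> bivariate_concentration_class P (Dclass p).
Proof.
move=> p01; split.
- by move=> C [].
- by move=> C; exact: Dclass_non_diversifiable.
- move=> C C' [hC Cp] hC' CC'; split => //; apply/eqP; rewrite eq_le.
  apply/andP; split; last by rewrite -{1}Cp.
  have := copula_le1 p p hC'; rewrite clamp_id//.
  by have /andP[p0 p1] := p01; rewrite (ltW p0) (ltW p1).
- move=> C lam DC lam0 lam1.
  have hC n : copula2 (C n) by have [] := DC n.
  split; first exact: mixture_copula.
  apply: cvg_lim => //.
  have -> : series (fun n => lam n * C n p p) = fun n => series lam n * p.
    apply/funext => n; rewrite /series /= mulr_suml; apply: eq_bigr => i _.
    by have [_ ->] := DC i.
  by rewrite -[X in _ --> X]mul1r; exact: cvgMl.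
Qed.

Theorem proposition9 (d : measure_display) (T : measurableType d)
  (R : realType) (P : probability T R) (hP : atomless P)
  (D : set (R -> R -> R)) (hD : D `<=` @copula2 R) :
  maximal_concentration_class P D <->
  exists p : R, 0 < p < 1 /\ D = Dclass p.
Proof.
split.
  move=> [bD maxD]; have [p p01 Dp] := bcc_sub_Dclass hP bD; exists p; split => //.
  apply: contrapT => nE; apply: maxD; exists (Dclass p); split => //.
    exact: Dclass_bcc.
  by move=> E; apply: nE; rewrite E.
move=> [p [p01 ->]]; split; first exact: Dclass_bcc.
move=> [D' [bD' nE sub]]; have [q q01 D'q] := bcc_sub_Dclass hP bD'.
have pq : p = q by apply: Dclass_sep => //; exact: subset_trans sub D'q.
by apply: nE; apply/seteqP; split => //; rewrite pq.
Qed.
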